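(* Let $\nu$ be a tempered measure on $\mathbb{R}^d$. Let $k\in\{0,1,\dots,d-1\}$ and let $L$ be a $k$-dimensional linear subspace of $\mathbb{R}^d$. If the set $$\{\zeta\in S^{d-1} : \text{there exists } \lambda>0 \text{ such that } \lambda\zeta\in\operatorname{spec}\nu\}$$ does not intersect some neighborhood of $L\cap S^{d-1}$, then for any $x\in\mathbb{R}^d$ we have $\underline{\dim}_{\mathrm{H}}\,\nu(x)\ge k$.
   Context: Measures are scalar and non-negative. A tempered measure is a locally finite measure $\nu$ on $\mathbb{R}^d$ for which there exist $N\in\mathbb{N}$ and $C>0$ with $\nu(B_R(0))\le CR^N$ for all $R\ge1$ (equivalently, a measure that is a Schwartz distribution). $B_r(x)$ is the closed Euclidean ball and $S^{d-1}$ the unit sphere in $\mathbb{R}^d$. The spectrum $\operatorname{spec}\nu$ is the support of the distributional Fourier transform $\hat\nu$, normalized by $\hat f(\xi)=\int_{\mathbb{R}^d}f(x)e^{-2\pi i\langle\xi,x\rangle}\,dx$. The local lower Hausdorff dimension is $\underline{\dim}_{\mathrm{H}}\,\nu(x)=\liminf_{r\to0}\dfrac{\log\nu(B_r(x))}{\log r}$ for $x\in\operatorname{supp}\nu$; for $x\notin\operatorname{supp}\nu$ it is understood as $+\infty$ (with $\log 0=-\infty$). *)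

(* Defs.v *)
From HB Require Import structures.
From mathcomp Require Import all_boot all_order all_algebra complex.
From mathcomp Require Import all_classical all_reals all_analysis.
From mathcomp Require Import measurable_realfun.

Set Implicit Arguments.
Unset Strict Implicit.
Unset Printing Implicit Defensive.

Import Order.TTheory GRing.Theory Num.Theory.
Import numFieldTopology.Exports numFieldNormedType.Exports.

Local Open Scope classical_set_scope.
Local Open Scope ring_scope.

(* Euclidean norm and closed Euclidean balls; the norm and the balls that the
   library puts on 'rV[R]_d are those of the sup norm (the topology is the same). *)
Section Euclidean.
Context {R : realType} {d : nat}.
Implicit Types x y : 'rV[R]_d.

Definition dotprod x y : R := \sum_(i < d) x 0 i * y 0 i.

Definition enorm x : R := Num.sqrt (dotprod x x).

Definition eball x (r : R) : set 'rV[R]_d := [set y | enorm (y - x) <= r].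

Definition unit_sphere : set 'rV[R]_d := [set x | enorm x = 1].

End Euclidean.

Section Borel.
Context {R : realType}.

HB.instance Definition _ (d : nat) :=
  @isMeasurable.Build (sigma_display (@open 'rV[R]_d)) 'rV[R]_d
    <<s (@open 'rV[R]_d) >>
    (@sigma_algebra0 _ setT _) (@sigma_algebraC _ _)
    (@sigma_algebra_bigcup _ setT _).

Lemma open_measurable_rV d (U : set 'rV[R]_d) : open U -> measurable U.
Proof. exact: sub_sigma_algebra. Qed.

Lemma rV_ballE d (x y : 'rV[R]_d) (e : R) :
  0 < e -> (ball x e y <-> forall i, `|x 0 i - y 0 i| < e).
Proof.
move=> e0; split=> [[_ xy] i|xy]; first exact: xy.
by split=> // i j; rewrite (ord1 i); exact: xy.
Qed.

Lemma measurable_fun_coord d i : measurable_fun setT (fun x : 'rV[R]_d => x 0 i).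
Proof.
apply: (measurability _ (RGenOInfty.measurableE R)).
move=> _ [_ [y ->] <-]; rewrite setTI; apply: open_measurable_rV.
apply: open_comp; last exact: interval_open.
by move=> x _; exact: coord_continuous.
Qed.

Lemma measurable_fun_rV (dT : measure_display) (T : measurableType dT) d
    (f : T -> 'rV[R]_d) :
  (forall i, measurable_fun setT (fun t => f t 0 i)) -> measurable_fun setT f.
Proof.
move=> mf; apply: (@measurability _ _ _ _ _ _ (@open 'rV[R]_d)) => //.
move=> _ [U oU <-]; rewrite setTI.
pose c (q : 'rV[rat]_d) : 'rV[R]_d := map_mx ratr q.
pose F (p : 'rV[rat]_d * nat) :=
  if `[< ball (c p.1) p.2.+1%:R^-1 `<=` U >]
  then f @^-1` ball (c p.1) p.2.+1%:R^-1 else set0.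
suff -> : f @^-1` U = \bigcup_p F p.
  apply: countable_bigcupT_measurable => // -[q n]; rewrite /F; case: ifP => //= _.
  have n0 : 0 < n.+1%:R^-1 :> R by rewrite invr_gt0.
  have -> : f @^-1` ball (c q) n.+1%:R^-1 =
      \bigcap_(i in [set: 'I_d]) [set t | `|c q 0 i - f t 0 i| < n.+1%:R^-1].
    apply/seteqP; split=> t /=; first by move/(rV_ballE _ _ n0) => h i _; exact: h.
    by move=> h; apply/(rV_ballE _ _ n0) => i; exact: h.
  apply: fin_bigcap_measurable => // i _.
  rewrite (_ : mkset _ = (fun t => f t 0 i) @^-1` ball (c q 0 i) n.+1%:R^-1)//.
  rewrite -[X in measurable X]setTI; apply: mf => //.
  by apply: open_measurable; exact: ball_open.
apply/seteqP; split=> t /=; last first.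
  by move=> [p _]; rewrite /F; case: ifP => // /asboolP; exact.
move=> Uft; have /nbhs_ballP[e /= e0 eU] := open_nbhs_nbhs (conj oU Uft).
have e20 : 0 < e / 2 by rewrite divr_gt0.
have [n _ /(_ n (leqnn n)) /= ne] := near_infty_natSinv_lt (PosNum e20).
have n0 : 0 < n.+1%:R^-1 :> R by rewrite invr_gt0.
have H (i : 'I_d) : exists q : rat,
    ratr q \in `](f t 0 i - n.+1%:R^-1), (f t 0 i + n.+1%:R^-1)[.
  by apply: rat_in_itvoo; rewrite ltrBlDr -addrA ltrDl addr_gt0.
have [q qP] := choice H.
have cq : ball (c (\row_i q i)) n.+1%:R^-1 (f t).
  apply/rV_ballE => // i; rewrite /c !mxE ltr_distl.
  by have := qP i; rewrite in_itv.
exists (\row_i q i, n) => //; rewrite /F /= asboolT//.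
move=> y cqy; apply: eU.
rewrite [e]splitr; apply: (@ball_triangle _ _ (c (\row_i q i))).
  by apply: le_ball (ball_sym cq); exact: ltW.
by apply: le_ball cqy; exact: ltW.
Qed.

End Borel.

Section Lebesgue.
Context {R : realType}.

Definition rV_cons n (p : measurableTypeR R * 'rV[R]_n) : 'rV[R]_n.+1 :=
  \row_i (if unlift ord0 i is Some j then p.2 0 j else p.1).

Let rV_uncons n (x : 'rV[R]_n.+1) : measurableTypeR R * 'rV[R]_n :=
  (x 0 ord0, \row_j x 0 (lift ord0 j)).

Let rV_consK n : cancel (@rV_cons n) (@rV_uncons n).
Proof.
move=> [a x]; congr pair; first by rewrite mxE unlift_none.
by apply/rowP => j; rewrite !mxE liftK.
Qed.

Lemma measurable_rV_cons n : measurable_fun setT (@rV_cons n).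
Proof.
apply: measurable_fun_rV => i; case: (unliftP ord0 i) => [j|] ->.
  rewrite (_ : (fun _ => _) = (fun x : 'rV_n => x 0 j) \o snd).
    by apply: measurableT_comp => //; exact: measurable_fun_coord.
  by apply/funext => p; rewrite mxE liftK.
rewrite (_ : (fun _ => _) = fst) //.
by apply/funext => p; rewrite mxE unlift_none.
Qed.

Let measurable_rV_uncons n : measurable_fun setT (@rV_uncons n).
Proof.
apply: measurable_fun_pair; first exact: measurable_fun_coord.
apply: measurable_fun_rV => j.
rewrite (_ : (fun _ => _) = (fun x : 'rV_n.+1 => x 0 (lift ord0 j))).
  exact: measurable_fun_coord.
by apply/funext => x; rewrite mxE.
Qed.

Section step.
Variables (n : nat) (mu : {sigma_finite_measure set 'rV[R]_n -> \bar R}).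

Definition rV_step : set 'rV[R]_n.+1 -> \bar R :=
  pushforward (@lebesgue_measure R \x mu)%E (@rV_cons n).

HB.instance Definition _ := Measure.copy rV_step
  (measure_function_pushforward__canonical__measure_function_Measure
    (@lebesgue_measure R \x mu)%E (@measurable_rV_cons n)).

Let rV_step_sigma_finite : sigma_finite setT rV_step.
Proof.
have /sigma_finiteP[F [FT ndF Foo]] := sigma_finiteT (@lebesgue_measure R).
have /sigma_finiteP[G [GT ndG Goo]] := sigma_finiteT mu.
exists (fun i => @rV_uncons n @^-1` (F i `*` G i)).
  rewrite -preimage_bigcup (_ : \bigcup_i _ = setT) ?preimage_setT//.
  rewrite -subTset => -[a x] _.
  have : setT a by []; rewrite [X in X a -> _]FT => -[i _ Fia].
  have : setT x by []; rewrite [X in X x -> _]GT => -[j _ Gjx].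
  exists (maxn i j) => //; split => /=.
  - by move: Fia; exact/subsetPset/ndF/leq_maxl.
  - by move: Gjx; exact/subsetPset/ndG/leq_maxr.
move=> i; have [mF Fi] := Foo i; have [mG Gi] := Goo i; split.
  rewrite -[X in measurable X]setTI; apply: measurable_rV_uncons => //.
  exact: measurableX.
rewrite /rV_step /pushforward -comp_preimage.
rewrite (_ : _ \o _ = id); last by apply/funext => p /=; rewrite rV_consK.
by rewrite preimage_id product_measure1E// lte_mul_pinfty// ge0_fin_numE.
Qed.

HB.instance Definition _ := Measure_isSigmaFinite.Build _ _ _ rV_step
  rV_step_sigma_finite.

End step.

(* Lebesgue measure on R^d: the product of d copies of the Lebesgue measure of
   R, built along R * R^n -> R^n.+1; see lebesgue_rV_box for its value on boxes. *)
Fixpoint lebesgue_rV (d : nat) : {sigma_finite_measure set 'rV[R]_d -> \bar R} :=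
  match d with
  | 0 => \d_(0 : 'rV[R]_0)
  | n.+1 => rV_step (lebesgue_rV n)
  end.

Lemma measurable_box d (A : 'I_d -> set R) : (forall i, measurable (A i)) ->
  measurable [set x : 'rV[R]_d | forall i, A i (x 0 i)].
Proof.
move=> mA; rewrite (_ : mkset _ =
    \bigcap_(i in [set: 'I_d]) ((fun x : 'rV[R]_d => x 0 i) @^-1` A i)).
  apply: fin_bigcap_measurable => // i _.
  by rewrite -[X in measurable X]setTI; exact: measurable_fun_coord.
by apply/seteqP; split=> [x xA i _|x xA i]; exact: xA.
Qed.

Lemma lebesgue_rV_box d (A : 'I_d -> set R) : (forall i, measurable (A i)) ->
  lebesgue_rV d [set x | forall i, A i (x 0 i)] =
  (\prod_(i < d) lebesgue_measure (A i))%E.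
Proof.
elim: d A => [|n IHn] A mA.
  rewrite big_ord0 /= diracE mem_set//= => -[].
  by case.
rewrite big_ord_recl -IHn; last by move=> i; exact: mA.
have mB : measurable [set x : 'rV[R]_n | forall i, A (lift ord0 i) (x 0 i)].
  by apply: (@measurable_box n (fun i => A (lift ord0 i))) => i; exact: mA.
rewrite -[RHS](product_measure1E (@lebesgue_measure R) (lebesgue_rV n) (mA ord0) mB).
rewrite /= /rV_step /pushforward; congr (_ _); apply/seteqP; split=> -[a x] /=.
  move=> H; split; first by have := H ord0; rewrite mxE unlift_none.
  by move=> i; have := H (lift ord0 i); rewrite mxE liftK.
move=> [Aa Ax] i; rewrite mxE.
by case: (unliftP ord0 i) => [j|] ->; [exact: Ax|].
Qed.

End Lebesgue.

Section ComplexIntegral.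
Context {R : realType}.

Definition expi (t : R) : R[i] := (cos t +i* sin t)%C.

Definition cintegral (dT : measure_display) (T : measurableType dT)
    (mu : {measure set T -> \bar R}) (f : T -> R[i]) : R[i] :=
  ((\int[mu]_x complex.Re (f x)) +i* (\int[mu]_x complex.Im (f x)))%C.

End ComplexIntegral.

Section Distributions.
Context {R : realType} {d : nat}.
Implicit Types (f : 'rV[R]_d -> R) (phi : 'rV[R]_d -> R[i]).

Definition partial (s : seq 'I_d) f : 'rV[R]_d -> R :=
  foldr (fun i g => 'D_('e_i) g) f s.

(* class C^oo: the partial derivatives of all orders exist and are continuous *)
Definition smooth f : Prop := forall s : seq 'I_d,
  continuous (partial s f) /\ forall i x, derivable (partial s f) x 'e_i.

Definition fun_support phi : set 'rV[R]_d := closure [set x | phi x != 0].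

Definition test_function (U : set 'rV[R]_d) phi : Prop :=
  [/\ smooth (fun x => complex.Re (phi x)), smooth (fun x => complex.Im (phi x)),
      compact (fun_support phi) & fun_support phi `<=` U].

(* support of a distribution: complement of the largest open set on which it
   vanishes *)
Definition distr_support (T : ('rV[R]_d -> R[i]) -> R[i]) : set 'rV[R]_d :=
  ~` \bigcup_(U in [set U | open U /\
                      forall phi, test_function U phi -> T phi = 0]) U.

Definition fourier phi (xi : 'rV[R]_d) : R[i] :=
  cintegral (lebesgue_rV d) (fun x => phi x * expi (- (2 * pi * dotprod xi x))).

End Distributions.

Section TemperedMeasures.
Context {R : realType} {d : nat} (nu : {measure set 'rV[R]_d -> \bar R}).

Definition tempered : Prop :=
  (forall x, exists2 U, open_nbhs x U & (nu U < +oo)%E) /\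
  exists N : nat, exists2 C : R, 0 < C &
    forall r : R, 1 <= r -> (nu (eball 0 r) <= (C * r ^+ N)%:E)%E.

(* <hat nu, phi> := <nu, hat phi>. Only used on test functions phi, for which
   hat phi is a Schwartz function, hence nu-integrable when nu is tempered. *)
Definition fourier_measure (phi : 'rV[R]_d -> R[i]) : R[i] :=
  cintegral nu (fourier phi).

Definition spec : set 'rV[R]_d := distr_support fourier_measure.

Definition spec_directions : set 'rV[R]_d :=
  [set z | unit_sphere z /\ exists2 lam : R, 0 < lam & spec (lam *: z)].

Definition measure_support : set 'rV[R]_d :=
  ~` \bigcup_(U in [set U | open U /\ nu U = 0%E]) U.

Definition lower_dim (x : 'rV[R]_d) : \bar R :=
  if x \in measure_support
  then limf_einf (fun r : R => lne (nu (eball x r)) / (ln r)%:E)%E 0^'+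
  else +oo%E.

End TemperedMeasures.

(* Main.v *)
Require Import Defs.
From HB Require Import structures.
From mathcomp Require Import all_boot all_order all_algebra complex.
From mathcomp Require Import all_classical all_reals all_analysis.
From mathcomp Require Import measurable_realfun ring lra.

(** Let [k = \dim L].  The theorem follows from a growth bound
    nu (B_r(x)) <= C r^k for small r ([eball_growth], [lower_dim_ge]), and the
    growth bound is an orthogonality argument.

    Write e(t) = exp (2 i pi t).  Take a smooth bump psi >= 0 supported in a small
    box around 0 and let G = |psi^|^2.  Three properties of G matter: it is
    nonnegative, it is nu-integrable because psi^ decays faster than any power
    ([power_spectrum_integrable]), and it is bounded below near x as soon as the
    box is small enough ([power_spectrum_lower]).  Moreover G is the Fourier
    transform of the autocorrelation of psi, so the integral of G(y) e(-<p,y>)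
    against nu is the value of nu^ on this autocorrelation translated by p.  It
    vanishes when a box around p, twice as large as that of psi, does not meet the
    spectrum ([power_spectrum_orthogonal]).

    The directions of the spectrum stay away from L, so the spectrum misses an open
    cone around L minus the origin, and this cone contains a box of any prescribed
    size around every point of L that is far enough from 0 ([spec_avoids_box]).  In
    L there are n^k points p_m, with m in {0, ..., n-1}^k, which are pairwise that
    far apart and of norm O(n): a coarse lattice ([separated_points]).
    Put D(y) = sum_m e(<p_m, y - x>).  When |D|^2 is expanded, the off-diagonal
    terms integrate to 0 against G nu, hence
      int G |D|^2 dnu = n^k int G dnu       ([integral_power_expsum]).
    On a ball of radius rho / n around x all the phases <p_m, y - x> are small, so
    that |D| >= n^k / 2 there.  Comparing both sides,
    n^(2k) nu (B_(rho/n)(x)) = O(n^k), which is the growth bound.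

    Two facts about distributions are used on the way.  First, nu^ vanishes on test
    functions whose support avoids the spectrum, although the spectrum is only
    defined by local vanishing ([fourier_measure_eq0]).  Second, transforms of test
    functions are nu-integrable; all the test functions needed are combinations
    of products of functions of one coordinate, so that this reduces to integration
    by parts on the line ([ft_decay]). *)

Set Implicit Arguments.
Unset Strict Implicit.
Unset Printing Implicit Defensive.

Import Order.TTheory GRing.Theory Num.Theory.
Import numFieldTopology.Exports numFieldNormedType.Exports.

Local Open Scope classical_set_scope.
Local Open Scope ring_scope.

(** * Integration of complex-valued functions *)

Section ComplexIntegration.
Context {R : realType} {dT : measure_display} {T : measurableType dT}.
Implicit Types (mu : {measure set T -> \bar R}) (f g : T -> R[i]).

Definition cintegrable mu f : Prop :=
  mu.-integrable setT (EFin \o (fun x => complex.Re (f x))) /\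
  mu.-integrable setT (EFin \o (fun x => complex.Im (f x))).

Lemma cintegrableD mu f g :
  cintegrable mu f -> cintegrable mu g -> cintegrable mu (fun x => f x + g x).
Proof.
move=> [fr fi] [gr gi]; split.
  have := integrableD measurableT fr gr; apply: eq_integrable => // x _ /=.
  by rewrite raddfD.
have := integrableD measurableT fi gi; apply: eq_integrable => // x _ /=.
by rewrite raddfD.
Qed.

Lemma cintegralD mu f g : cintegrable mu f -> cintegrable mu g ->
  cintegral mu (fun x => f x + g x) = cintegral mu f + cintegral mu g.
Proof.
move=> [fr fi] [gr gi]; rewrite /cintegral; simpc; congr (_ +i* _)%C.
  rewrite -RintegralD//; apply: eq_Rintegral => x _.
  by rewrite raddfD.
rewrite -RintegralD//; apply: eq_Rintegral => x _.
by rewrite raddfD.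
Qed.

Lemma eq_cintegral mu f g : f =1 g -> cintegral mu f = cintegral mu g.
Proof. by move=> /funext ->. Qed.

Lemma ReM (z w : R[i]) : complex.Re (z * w) =
  complex.Re z * complex.Re w - complex.Im z * complex.Im w.
Proof. by case: z w => [a b] [c d]. Qed.

Lemma ImM (z w : R[i]) : complex.Im (z * w) =
  complex.Re z * complex.Im w + complex.Im z * complex.Re w.
Proof. by case: z w => [a b] [c d] /=. Qed.

Lemma cintegrableZ mu (c : R[i]) f :
  cintegrable mu f -> cintegrable mu (fun x => c * f x).
Proof.
move=> [fr fi]; split.
  have := integrableB measurableT (integrableZl measurableT (complex.Re c) fr)
    (integrableZl measurableT (complex.Im c) fi).
  by apply: eq_integrable => // x _ /=; rewrite ReM.
have := integrableD measurableT (integrableZl measurableT (complex.Re c) fi)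
    (integrableZl measurableT (complex.Im c) fr).
by apply: eq_integrable => // x _ /=; rewrite ImM.
Qed.

Lemma cintegralZ mu (c : R[i]) f : cintegrable mu f ->
  cintegral mu (fun x => c * f x) = c * cintegral mu f.
Proof.
move=> [fr fi]; rewrite /cintegral.
have Z (a : R) (h : T -> R) : mu.-integrable setT (EFin \o h) ->
    mu.-integrable setT (EFin \o (fun x => a * h x)).
  by move=> ih; exact: (integrableZl measurableT a ih).
have rZ (a : R) (h : T -> R) : mu.-integrable setT (EFin \o h) ->
    \int[mu]_x (a * h x) = a * \int[mu]_x h x.
  by move=> ih; rewrite RintegralZl.
case: c => a b; simpc; congr (_ +i* _)%C.
  rewrite -!rZ// -RintegralB//; [|exact: Z..].
  by apply: eq_Rintegral => x _; rewrite ReM.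
rewrite -!rZ// -RintegralD//; [|exact: Z..].
by apply: eq_Rintegral => x _; rewrite ImM.
Qed.

Lemma cintegrable0 mu : cintegrable mu (fun=> 0).
Proof. by split; exact: integrable0. Qed.

Lemma cintegral0 mu : cintegral mu (fun=> 0) = 0.
Proof. by rewrite /cintegral/= /Rintegral !integral0. Qed.

Lemma cintegrable_sum mu (I : Type) (s : seq I) (F : I -> T -> R[i]) :
  (forall i, cintegrable mu (F i)) ->
  cintegrable mu (fun x => \sum_(i <- s) F i x) /\
  cintegral mu (fun x => \sum_(i <- s) F i x) =
    \sum_(i <- s) cintegral mu (F i).
Proof.
move=> iF; elim: s => [|i s [IH1 IH2]].
  under eq_fun do rewrite big_nil.
  by split; [exact: cintegrable0|rewrite big_nil cintegral0].
under eq_fun do rewrite big_cons.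
by split; [exact: cintegrableD|rewrite big_cons cintegralD// IH2].
Qed.

Definition cmeasurable f : Prop :=
  measurable_fun setT (fun x => complex.Re (f x)) /\
  measurable_fun setT (fun x => complex.Im (f x)).

Lemma cintegrable_measurable mu f : cintegrable mu f -> cmeasurable f.
Proof.
move=> [/measurable_int mr /measurable_int mi].
by split; apply/measurable_EFinP.
Qed.

Lemma cmeasurableM f g : cmeasurable f -> cmeasurable g ->
  cmeasurable (fun x => f x * g x).
Proof.
move=> [fr fi] [gr gi]; split.
  under eq_fun do rewrite ReM.
  by apply: measurable_funB; exact: measurable_funM.
under eq_fun do rewrite ImM.
by apply: measurable_funD; exact: measurable_funM.
Qed.

(** A real-valued norm on the complex numbers.  It is equivalent to the modulus, and its
    integrability is that of the real and imaginary parts. *)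
Definition cabs (z : R[i]) : R := `|complex.Re z| + `|complex.Im z|.

Lemma cabs_ge0 z : 0 <= cabs z. Proof. by rewrite addr_ge0. Qed.

Lemma cabsM z w : cabs (z * w) <= cabs z * cabs w.
Proof.
rewrite /cabs ReM ImM.
rewrite (@le_trans _ _ (`|complex.Re z * complex.Re w| +
  `|complex.Im z * complex.Im w| + (`|complex.Re z * complex.Im w| +
  `|complex.Im z * complex.Re w|)))//.
  by rewrite lerD// ?ler_normB// ler_normD.
by rewrite !normrM; lra.
Qed.

Definition abs2 (z : R[i]) : R := complex.Re z ^+ 2 + complex.Im z ^+ 2.

Lemma abs2_ge0 z : 0 <= abs2 z.
Proof. by rewrite addr_ge0// sqr_ge0. Qed.

Lemma abs2E z : ((abs2 z)%:C)%C = z * (complex.Re z -i* complex.Im z)%C.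
Proof. by case: z => u v; rewrite /abs2/=; simpc; congr (_ +i* _)%C; ring. Qed.

Lemma cmeasurable_cabs f : cmeasurable f -> measurable_fun setT (fun x => cabs (f x)).
Proof.
by move=> [fr fi]; apply: measurable_funD; apply: measurableT_comp.
Qed.

Lemma cintegrable_cabs mu f : cintegrable mu f ->
  mu.-integrable setT (EFin \o (fun x => cabs (f x))).
Proof.
move=> [fr fi].
by have := integrableD measurableT (integrable_norm fr) (integrable_norm fi).
Qed.

Lemma le_cintegrable mu f (h : T -> R) : cmeasurable f ->
  (forall x, cabs (f x) <= h x) -> mu.-integrable setT (EFin \o h) ->
  cintegrable mu f.
Proof.
move=> [fr fi] fh ih; split; (apply: le_integrable ih => //;
  [exact/measurable_EFinP|move=> x _ /=; rewrite lee_fin]);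
  rewrite (le_trans _ (ler_norm _))// (le_trans _ (fh x))// /cabs ?lerDl ?lerDr//.
Qed.

Lemma cintegrableM_bounded mu f g (M : R) : cintegrable mu f -> cmeasurable g ->
  (forall x, cabs (g x) <= M) -> cintegrable mu (fun x => f x * g x).
Proof.
move=> fi mg gM; apply: (@le_cintegrable _ _ (fun x => M * cabs (f x))).
- by apply: cmeasurableM => //; exact: cintegrable_measurable fi.
- move=> x; rewrite (le_trans (cabsM _ _))// mulrC.
  by rewrite ler_wpM2r// cabs_ge0.
- exact: (integrableZl measurableT M (cintegrable_cabs fi)).
Qed.

Lemma cabs_cintegral mu f : cintegrable mu f ->
  cabs (cintegral mu f) <= \int[mu]_x cabs (f x).
Proof.
move=> [fr fi]; rewrite /cabs/= RintegralD//; [|exact: integrable_norm..].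
by rewrite lerD// le_normr_Rintegral.
Qed.

End ComplexIntegration.

Section ComplexFubini.
Context {R : realType} {d1 d2 : measure_display}
  {T1 : measurableType d1} {T2 : measurableType d2}.
Variables (m1 : {sigma_finite_measure set T1 -> \bar R})
  (m2 : {sigma_finite_measure set T2 -> \bar R}).

Lemma cintegrableX (f : T1 -> R[i]) (g : T2 -> R[i]) :
  cintegrable m1 f -> cintegrable m2 g ->
  cintegrable (m1 \x m2)%E (fun p => f p.1 * g p.2).
Proof.
move=> fi gi.
have cf := cintegrable_cabs fi; have cg := cintegrable_cabs gi.
have mcf : measurable_fun setT (fun x => cabs (f x)).
  by apply/measurable_EFinP; exact: measurable_int cf.
have mcg : measurable_fun setT (fun x => cabs (g x)).
  by apply/measurable_EFinP; exact: measurable_int cg.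
have [[fr fI] [gr gI]] := (cintegrable_measurable fi, cintegrable_measurable gi).
apply: (@le_cintegrable _ _ _ _ _ (fun p => cabs (f p.1) * cabs (g p.2))).
- apply: (@cmeasurableM _ _ _ (fun p : T1 * T2 => f p.1) (fun p => g p.2)); split.
  + exact: (measurableT_comp fr).
  + exact: (measurableT_comp fI).
  + exact: (measurableT_comp gr).
  + exact: (measurableT_comp gI).
- by move=> p; exact: cabsM.
- apply/integrable12ltyP.
    apply/measurable_EFinP; apply: measurable_funM; first exact: (measurableT_comp mcf).
    exact: (measurableT_comp mcg).
  have -> : (fun x => \int[m2]_y `|(EFin \o (fun p : T1 * T2 =>
      (cabs (f p.1) * cabs (g p.2))%R)) (x, y)|)%E =
      (fun x => (cabs (f x))%:E * (\int[m2]_y `|(cabs (g y))%:E|))%E.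
    apply/funext => x; rewrite -ge0_integralZl//=; last by rewrite lee_fin cabs_ge0.
      by apply: eq_integral => y _; rewrite normrM EFinM (ger0_norm (cabs_ge0 (f x))).
    by apply: measurableT_comp => //; apply: measurableT_comp.
  rewrite ge0_integralZr//=.
  - apply: lte_mul_pinfty.
    + by apply: integral_ge0 => x _; rewrite lee_fin cabs_ge0.
    + rewrite ge0_fin_numE; last by apply: integral_ge0 => x _; rewrite lee_fin cabs_ge0.
      have /integrableP[_] := cf; apply: le_lt_trans; apply: ge0_le_integral => //.
      * by move=> x _; rewrite lee_fin cabs_ge0.
      * exact/measurable_EFinP.
      * by apply: measurableT_comp => //; exact/measurable_EFinP.
      * by move=> x _ /=; rewrite lee_fin ler_norm.
    + by have /integrableP[_] := cg.
  - exact/measurable_EFinP.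
  - by move=> x _; rewrite lee_fin cabs_ge0.
  - exact: integral_ge0.
Qed.

(** Integrability of every section, and not of almost every one, is what makes the
    real-valued inner integrals agree with the extended ones. *)
Lemma cintegral12 (f : T1 * T2 -> R[i]) : cintegrable (m1 \x m2)%E f ->
  (forall x, cintegrable m2 (fun y => f (x, y))) ->
  cintegral m1 (fun x => cintegral m2 (fun y => f (x, y))) =
  cintegral (m1 \x m2)%E f.
Proof.
move=> [fr fi] sf; rewrite /cintegral/=; congr (_ +i* _)%C; rewrite /Rintegral.
  rewrite -integral12_prod_meas1//; congr fine; apply: eq_integral => x _.
  by rewrite fineK//; apply: integrable_fin_num => //; case: (sf x).
rewrite -integral12_prod_meas1//; congr fine; apply: eq_integral => x _.
by rewrite fineK//; apply: integrable_fin_num => //; case: (sf x).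
Qed.

Lemma cintegral21 (f : T1 * T2 -> R[i]) : cintegrable (m1 \x m2)%E f ->
  (forall y, cintegrable m1 (fun x => f (x, y))) ->
  cintegral m2 (fun y => cintegral m1 (fun x => f (x, y))) =
  cintegral (m1 \x m2)%E f.
Proof.
move=> [fr fi] sf; rewrite /cintegral/=; congr (_ +i* _)%C; rewrite /Rintegral.
  rewrite -integral21_prod_meas1//; congr fine; apply: eq_integral => x _.
  by rewrite fineK//; apply: integrable_fin_num => //; case: (sf x).
rewrite -integral21_prod_meas1//; congr fine; apply: eq_integral => x _.
by rewrite fineK//; apply: integrable_fin_num => //; case: (sf x).
Qed.

Lemma cintegralX (f : T1 -> R[i]) (g : T2 -> R[i]) :
  cintegrable m1 f -> cintegrable m2 g ->
  cintegral (m1 \x m2)%E (fun p => f p.1 * g p.2) =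
  cintegral m1 f * cintegral m2 g.
Proof.
move=> fi gi; rewrite -cintegral12/=; first last.
- by move=> x; exact: cintegrableZ.
- exact: cintegrableX.
rewrite mulrC -cintegralZ//; apply: eq_cintegral => x.
by rewrite cintegralZ// mulrC.
Qed.

End ComplexFubini.

(** * Products of functions of one coordinate, and translations of the line *)

Section ProductFunctions.
Context {R : realType}.
Local Notation mu := (@lebesgue_measure R).

Lemma cintegrable_image {dT dU : measure_display} {T : measurableType dT}
    {U : measurableType dU} (m : {measure set T -> \bar R})
    (m' : {measure set U -> \bar R}) (phi : T -> U) (f : U -> R[i]) :
  measurable_fun setT phi ->
  (forall A, measurable A -> m' A = m (phi @^-1` A)) ->
  cmeasurable f -> cintegrable m (f \o phi) ->
  cintegrable m' f /\ cintegral m' f = cintegral m (f \o phi).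
Proof.
move=> mphi mm' [mr mi] [fr fi].
pose mp := measure_function_pushforward__canonical__measure_function_Measure m mphi.
have mE (g : U -> \bar R) : (\int[m']_x g x = \int[mp]_x g x)%E.
  by apply: eq_measure_integral => A mA _; exact: mm'.
have ig (g : U -> R) : measurable_fun setT g ->
    m.-integrable setT (EFin \o (g \o phi)) ->
    m'.-integrable setT (EFin \o g) /\ \int[m']_x g x = \int[m]_x g (phi x).
  move=> mg ig; have mEg : measurable_fun setT (EFin \o g) by exact/measurable_EFinP.
  split.
    apply/integrableP; split => //; rewrite mE.
    by have /integrableP[] := integrable_pushforward mphi (D := setT) mEg ig measurableT.
  by rewrite /Rintegral mE (integral_pushforward mphi).
have [ir re] := ig _ mr fr; have [ii ie] := ig _ mi fi.
by split; [split|rewrite /cintegral re ie].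
Qed.

Definition cprod {d} (f : 'I_d -> R -> R[i]) (x : 'rV[R]_d) : R[i] :=
  \prod_(i < d) f i (x 0 i).

Lemma cmeasurable_cst {dT : measure_display} {T : measurableType dT} (c : R[i]) :
  cmeasurable (fun _ : T => c).
Proof. by split; exact: measurable_cst. Qed.

Lemma cmeasurable_prod {dT : measure_display} {T : measurableType dT} (I : Type)
    (s : seq I) (f : I -> T -> R[i]) :
  (forall i, cmeasurable (f i)) -> cmeasurable (fun x => \prod_(i <- s) f i x).
Proof.
move=> mf; elim: s => [|i s IH].
  by under eq_fun do rewrite big_nil; exact: cmeasurable_cst.
by under eq_fun do rewrite big_cons; exact: cmeasurableM.
Qed.

Lemma cmeasurable_cprod d (f : 'I_d -> R -> R[i]) :
  (forall i, cmeasurable (f i)) -> cmeasurable (cprod f).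
Proof.
move=> mf; apply: cmeasurable_prod => i; have [fr fi] := mf i.
by split; [apply: (measurableT_comp fr)|apply: (measurableT_comp fi)];
  exact: measurable_fun_coord.
Qed.

Lemma cprod_cons d (f : 'I_d.+1 -> R -> R[i]) :
  cprod f \o (@rV_cons R d) = (fun p => f ord0 p.1 * cprod (fun i => f (lift ord0 i)) p.2).
Proof.
apply/funext => p; rewrite /= /cprod big_ord_recl !mxE unlift_none; congr (_ * _).
by apply: eq_bigr => i _; rewrite mxE liftK.
Qed.

(** Fubini, one coordinate at a time: the Lebesgue measure of dimension [d.+1] is the
    image of a product measure under [rV_cons]. *)
Lemma cintegral_cprod d (f : 'I_d -> R -> R[i]) : (forall i, cintegrable mu (f i)) ->
  cintegrable (lebesgue_rV d) (cprod f) /\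
  cintegral (lebesgue_rV d) (cprod f) = \prod_(i < d) cintegral mu (f i).
Proof.
elim: d f => [|d IHd] f fi.
  have -> : cprod f = fun=> 1 by apply/funext => x; rewrite /cprod big_ord0.
  rewrite big_ord0 /= /cintegral/= /Rintegral; split; last first.
    by rewrite integral_dirac//= indicT mul1r integral0.
  split; apply/integrableP; split; try by exact/measurable_EFinP.
    by rewrite /= integral_dirac//= normr1 diracT mul1e ltry.
  by rewrite /= integral_dirac//= normr0 diracT mul1e ltry.
have [IH1 IH2] := IHd (fun i => f (lift ord0 i)) (fun i => fi _).
have mf : cmeasurable (cprod f).
  by apply: cmeasurable_cprod => i; exact: cintegrable_measurable (fi i).
have int := cintegrableX (fi ord0) IH1.
rewrite big_ord_recl -IH2 -cintegralX//.
rewrite -cprod_cons in int *; apply: cintegrable_image => //.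
exact: measurable_rV_cons.
Qed.

Lemma lebesgue_measure_shift (c : R) (A : set (measurableTypeR R)) :
  measurable A -> mu A = mu ((fun t => t + c) @^-1` A).
Proof.
have mc : measurable_fun setT (fun t : measurableTypeR R => t + c : measurableTypeR R).
  exact: measurable_funD.
move: A; apply: (@lebesgue_measure_unique R
  (measure_function_pushforward__canonical__measure_function_Measure mu mc)).
move=> _ [[a b] /= _ <-]; rewrite /pushforward.
have -> : (fun t => t + c) @^-1` `]a, b] = `](a - c), (b - c)]%classic.
  by apply/seteqP; split => t /=; rewrite !in_itv/= ltrBlDr lerBrDr.
by rewrite !lebesgue_measure_itv/= !lte_fin ltrD2r; case: ifP => // _;
  rewrite -!EFinB; congr _%:E; ring.
Qed.

Lemma cintegral_shift (c : R) (f : R -> R[i]) :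
  cintegrable mu f -> cintegrable mu (fun t => f (t + c)) /\
  cintegral mu (fun t => f (t + c)) = cintegral mu f.
Proof.
move=> fi; have [fr fI] := cintegrable_measurable fi.
have mD (e : R) : measurable_fun setT (fun t : measurableTypeR R => t + e : measurableTypeR R).
  exact: measurable_funD.
have := @cintegrable_image _ _ _ _ mu mu (fun t => t - c) (fun t => f (t + c)) (mD _).
have -> : (fun t => f (t + c)) \o (fun t => t - c) = f.
  by apply/funext => t /=; rewrite subrK.
apply => //; first exact: lebesgue_measure_shift.
split; [exact: (measurableT_comp fr (mD c))|exact: (measurableT_comp fI (mD c))].
Qed.

End ProductFunctions.

(** * Smooth functions on the line and smooth cutoffs *)

Section SmoothLine.
Context {R : realType}.
Implicit Types (f g : R -> R) (n : nat).

(** Recursion on the number of derivatives lets each closure property be proved by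
    induction, without a formula for the [n]-th derivative. *)
Fixpoint Cn (n : nat) f : Prop :=
  if n is m.+1 then (forall x, derivable f x 1) /\ Cn m (derive1 f) else True.

Definition smooth1 f : Prop := forall n, Cn n f.

Lemma CnS_is_derive n f g :
  (forall x : R, is_derive x 1 f (g x)) -> Cn n g -> Cn n.+1 f.
Proof.
move=> fg cg /=; split=> [x|]; first by have [] := fg x.
suff -> : (derive1 f) = g by [].
by apply/funext => x; rewrite derive1E; have [_ ->] := fg x.
Qed.

Lemma Cn_is_derive n f : Cn n.+1 f ->
  (forall x : R, is_derive x 1 f ((derive1 f) x)) /\ Cn n (derive1 f).
Proof. by move=> /= [df cf]; split=> // x; rewrite derive1E; exact/derivableP. Qed.

Lemma CnW n f : Cn n.+1 f -> Cn n f.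
Proof.
by elim: n f => [//|n IH] f [df cf] /=; split=> //; exact: IH.
Qed.

Lemma Cn_cst n (c : R) : Cn n (fun=> c).
Proof.
elim: n c => [//|n IH] c; exact: (@CnS_is_derive _ _ (fun=> 0)).
Qed.

Lemma CnD n f g : Cn n f -> Cn n g -> Cn n (fun x => f x + g x).
Proof.
elim: n f g => [//|n IH] f g /Cn_is_derive[df cf] /Cn_is_derive[dg cg].
by apply: CnS_is_derive (IH _ _ cf cg) => x; exact: is_deriveD.
Qed.

Lemma CnM n f g : Cn n f -> Cn n g -> Cn n (fun x => f x * g x).
Proof.
elim: n f g => [//|n IH] f g cf' cg'.
have [[df cf] [dg cg]] := (Cn_is_derive cf', Cn_is_derive cg').
apply: (@CnS_is_derive _ _ (fun x => f x * (derive1 g) x + g x * (derive1 f) x)).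
by apply: CnD; apply: IH => //; exact: CnW.
Qed.

Lemma Cn_inv n g : (forall x, g x != 0) -> Cn n g -> Cn n (fun x => (g x)^-1).
Proof.
move=> g0; elim: n => [//|n IH] cg'; have [dg cg] := Cn_is_derive cg'.
apply: (@CnS_is_derive _ _ (fun x => (-1 * (derive1 g) x) * ((g x)^-1 * (g x)^-1))).
  move=> x; have h := is_deriveV (g0 x) (dg x).
  apply: is_derive_eq h _; rewrite /GRing.scale/= expr2 invfM; ring.
have ci := IH (CnW cg').
by apply: CnM; apply: CnM => //; exact: Cn_cst.
Qed.

Lemma Cn_affine n f (a b : R) : Cn n f -> Cn n (fun x => f (a * x + b)).
Proof.
elim: n f => [//|n IH] f /Cn_is_derive[df cf].
apply: (@CnS_is_derive _ _ (fun x => a * (derive1 f) (a * x + b))).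
  move=> x.
  have h : is_derive x 1 (fun x => a * x + b) a.
    by apply: is_derive_eq; rewrite addr0 scaler1//.
  have := @is_derive1_comp R f (fun x => a * x + b) x _ _ (df _) h.
  by rewrite mulrC.
by apply: CnM; [exact: Cn_cst|exact: IH].
Qed.

(** The family t^(-n) exp (-1/t), extended by 0 for t <= 0, is closed under
    derivation up to linear combinations; [flat 0] is the classical smooth function
    which is flat at 0. *)
Definition flat n (t : R) : R := if 0 < t then t^-1 ^+ n * expR (- t^-1) else 0.

Lemma flat_ge0 n t : 0 <= flat n t.
Proof.
by rewrite /flat; case: ifP => // t0; rewrite mulr_ge0 ?expR_ge0// exprn_ge0// invr_ge0 ltW.
Qed.

(** One term of the exponential series of 1/t. *)
Lemma flat_le n t : 0 < t -> flat n t <= n.+1`!%:R * t.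
Proof.
move=> t0; rewrite /flat t0 expRN ler_pdivrMr ?expR_gt0//.
have u0 : 0 <= t^-1 by rewrite invr_ge0 ltW.
have fact0 : 0 < n.+1`!%:R :> R by rewrite ltr0n fact_gt0.
have h : t^-1 ^+ n.+1 <= n.+1`!%:R * expR t^-1.
  rewrite mulrC -ler_pdivrMr// (le_trans _ (expR_ge1Dxn n u0))//.
  by rewrite lerDr.
have -> : t^-1 ^+ n = t * t^-1 ^+ n.+1 by rewrite exprS mulrA divff ?mul1r ?gt_eqF.
by rewrite mulrAC mulrC ler_wpM2r// ltW.
Qed.

Lemma flat_eq0 n t : t <= 0 -> flat n t = 0.
Proof. by move=> t0; rewrite /flat ltNge t0. Qed.

Lemma is_derive_flat n (t : R) :
  is_derive t 1 (flat n) (flat n.+2 t - n%:R * flat n.+1 t).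
Proof.
have [t0|t0|->] := ltgtP t 0.
- rewrite !flat_eq0 ?ltW// mulr0 subr0.
  apply: (@near_eq_is_derive _ _ _ (fun=> 0)).
  near=> s; rewrite flat_eq0// ltW//; near: s; exact: lt_nbhsl.
- apply: (@near_eq_is_derive _ _ _ (fun t : R => t^-1 ^+ n * expR (- t^-1))).
    near=> s; rewrite /flat; case: ifPn => // /negP; case.
    near: s; exact: lt_nbhsr.
  have tn0 : t != 0 by rewrite gt_eqF.
  have dV : is_derive t 1 (fun s : R => s^-1) (- t ^- 2).
    have h := @is_deriveV R id t 1 1 tn0 (is_derive_id _ _).
    by apply: is_derive_eq h _; rewrite scaler1.
  have dVn : is_derive t 1 (fun s : R => s^-1 ^+ n) (- n%:R * t^-1 ^+ n.+1).
    have h := @is_deriveX R R (fun s : R => s^-1) n t 1 _ dV.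
    have e : (fun s : R => s^-1 ^+ n) = (fun s : R => s^-1) ^+ n.
      by apply/funext => s; rewrite exprfctE.
    rewrite e; apply: is_derive_eq h _; rewrite /GRing.scale/=.
    case: (n) => [|m]; first by rewrite oppr0 !mul0r.
    rewrite -[m.+1.-1]/m (exprS _ m.+1) (exprS _ m) -exprVn; ring.
  have dN : is_derive t 1 (fun s : R => - s^-1) (t ^- 2).
    have h := is_deriveN dV.
    by apply: is_derive_eq h _; rewrite opprK.
  have dE := @is_derive1_comp R expR (fun s : R => - s^-1) t _ _ (is_derive_expR _) dN.
  have h := is_deriveM dVn dE.
  apply: is_derive_eq h _; rewrite /flat t0 /GRing.scale/=.
  rewrite (exprS _ n.+1) (exprS _ n) -exprVn; ring.
(* At 0 the difference quotient of [flat n] is [flat n.+1], which is O(t). *)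
- rewrite !flat_eq0// mulr0 subr0.
  have h0 : (fun h : R => h^-1 *: (flat n (h *: 1 + 0) - flat n 0)) @ 0^' --> (0:R).
    apply/cvgr0Pnorm_le => e e0; near=> h.
    rewrite addr0 (flat_eq0 n (lexx 0)) subr0 /GRing.scale/= mulr1.
    have [h0|h0] := lerP h 0; first by rewrite flat_eq0// mulr0 normr0 ltW.
    have -> : h^-1 * flat n h = flat n.+1 h.
      by rewrite /flat h0 exprS mulrA.
    rewrite ger0_norm ?flat_ge0// (le_trans (flat_le _ h0))//.
    rewrite -ler_pdivlMl ?ltr0n ?fact_gt0//.
    rewrite (le_trans (ler_norm _))//; near: h; apply: dnbhs0_le.
    by rewrite mulr_gt0// invr_gt0 ltr0n fact_gt0.
  by apply: DeriveDef; [apply/cvg_ex; exists 0|exact/cvg_lim].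
Unshelve. all: by end_near. Qed.

Lemma Cn_flat m n : Cn m (flat n).
Proof.
elim: m n => [//|m IH] n; apply: (CnS_is_derive (is_derive_flat n)).
apply: CnD => //; under eq_fun do rewrite -mulNr.
by apply: CnM => //; exact: Cn_cst.
Qed.

Lemma flat0_gt0 t : 0 < t -> 0 < flat 0 t.
Proof. by move=> t0; rewrite /flat t0 mul1r expR_gt0. Qed.

Definition step (t : R) : R := flat 0 t / (flat 0 t + flat 0 (1 - t)).

Lemma step_den_gt0 t : 0 < flat 0 t + flat 0 (1 - t).
Proof.
have [t0|t0] := lerP t 0.
  by rewrite ltr_wpDl ?flat_ge0// flat0_gt0//; lra.
by rewrite ltr_pwDl ?flat_ge0// flat0_gt0.
Qed.

Lemma smooth1_step : smooth1 step.
Proof.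
move=> n; apply: CnM; first exact: Cn_flat.
apply: Cn_inv => [t|]; first by rewrite gt_eqF// step_den_gt0.
apply: CnD; first exact: Cn_flat.
have := Cn_affine (-1) 1 (Cn_flat n 0); congr Cn; apply/funext => t; congr flat; ring.
Qed.

Lemma step_ge0 t : 0 <= step t.
Proof. by rewrite divr_ge0 ?addr_ge0 ?flat_ge0. Qed.

Lemma step_eq0 t : t <= 0 -> step t = 0.
Proof. by move=> t0; rewrite /step flat_eq0// mul0r. Qed.

Lemma step_eq1 t : 1 <= t -> step t = 1.
Proof.
move=> t1; rewrite /step [flat 0 (1 - t)]flat_eq0 ?subr_le0// addr0 divff//.
by rewrite gt_eqF// flat0_gt0// (lt_le_trans _ t1).
Qed.

(** The product of the steps 2 + 2 (t - c) / r and 2 - 2 (t - c) / r, with arguments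
    written as affine functions of [t]. *)
Definition cutoff (r c t : R) : R :=
  step (2 * r^-1 * t + (2 - 2 * r^-1 * c)) * step (- (2 * r^-1) * t + (2 + 2 * r^-1 * c)).

Lemma smooth1_cutoff r c : smooth1 (cutoff r c).
Proof. by move=> n; apply: CnM; apply: Cn_affine; exact: smooth1_step. Qed.

Lemma cutoff_ge0 r c t : 0 <= cutoff r c t.
Proof. by rewrite mulr_ge0// step_ge0. Qed.

Lemma cutoff_eq1 r c t : 0 < r -> `|t - c| <= r / 2 -> cutoff r c t = 1.
Proof.
move=> r0; rewrite ler_norml => /andP[h1 h2]; rewrite /cutoff !step_eq1 ?mulr1//.
  have -> : - (2 * r^-1) * t + (2 + 2 * r^-1 * c) = 2 - (t - c) * 2 / r by field; rewrite gt_eqF.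
  have : (t - c) * 2 / r <= 1 by rewrite ler_pdivrMr//; lra.
  lra.
have -> : 2 * r^-1 * t + (2 - 2 * r^-1 * c) = 2 - (c - t) * 2 / r by field; rewrite gt_eqF.
have : (c - t) * 2 / r <= 1 by rewrite ler_pdivrMr//; lra.
lra.
Qed.

Lemma cutoff_eq0 r c t : 0 < r -> r <= `|t - c| -> cutoff r c t = 0.
Proof.
move=> r0; rewrite ler_normr /cutoff => /orP[h|h].
  rewrite (@step_eq0 (- (2 * r^-1) * t + (2 + 2 * r^-1 * c))) ?mulr0//.
  have -> : - (2 * r^-1) * t + (2 + 2 * r^-1 * c) = 2 - (t - c) * 2 / r by field; rewrite gt_eqF.
  have : 2 <= (t - c) * 2 / r by rewrite ler_pdivlMr//; lra.
  lra.
rewrite step_eq0 ?mul0r//.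
have -> : 2 * r^-1 * t + (2 - 2 * r^-1 * c) = 2 - (c - t) * 2 / r by field; rewrite gt_eqF.
have : 2 <= (c - t) * 2 / r by rewrite ler_pdivlMr//; lra.
lra.
Qed.

End SmoothLine.

(** * Characters *)

Section Characters.
Context {R : realType}.

Lemma expiD (s t : R) : expi (s + t) = expi s * expi t.
Proof.
rewrite /expi cosD sinD; simpc; congr (_ +i* _)%C; ring.
Qed.

Lemma expi0 : expi 0 = 1 :> R[i].
Proof. by rewrite /expi cos0 sin0. Qed.

Lemma expi_sum (I : Type) (s : seq I) (f : I -> R) :
  expi (\sum_(i <- s) f i) = \prod_(i <- s) expi (f i).
Proof. by apply: (big_morph expi expiD expi0). Qed.

Lemma cabs_expi (t : R) : cabs (expi t) <= 2.
Proof. by rewrite /cabs/=; have := cos_max t; have := sin_max t; lra. Qed.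

Lemma cmeasurable_expi {dT : measure_display} {T : measurableType dT} (f : T -> R) :
  measurable_fun setT f -> cmeasurable (fun x => expi (f x)).
Proof.
move=> mf; split.
  by apply: (measurableT_comp _ mf); apply: continuous_measurable_fun; exact: continuous_cos.
by apply: (measurableT_comp _ mf); apply: continuous_measurable_fun; exact: continuous_sin.
Qed.

End Characters.

(** * Smooth functions of compact support on the line *)

Section Bumps.
Context {R : realType}.
Local Notation mu := (@lebesgue_measure R).
Implicit Types a b : R -> R.

Definition bump a : Prop :=
  smooth1 a /\ exists2 r : R, 0 < r & forall t, r <= `|t| -> a t = 0.

Lemma smooth1_derive1 a : smooth1 a -> smooth1 (derive1 a).
Proof. by move=> sa n; have [] := sa n.+1. Qed.

Lemma smooth1_is_derive a (x : R) : smooth1 a -> is_derive x 1 a (derive1 a x).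
Proof. by move=> sa; have [] := Cn_is_derive (sa 1%N). Qed.

Lemma smooth1_continuous a : smooth1 a -> continuous a.
Proof.
move=> sa x; apply: differentiable_continuous; apply/derivable1_diffP.
by have [] := sa 1%N.
Qed.

Lemma smooth1M a b : smooth1 a -> smooth1 b -> smooth1 (fun t => a t * b t).
Proof. by move=> sa sb n; exact: CnM. Qed.

Lemma bumpM a b : bump a -> smooth1 b -> bump (fun t => a t * b t).
Proof.
move=> [sa [r r0 ar]] sb; split; first exact: smooth1M.
by exists r => // t rt; rewrite ar// mul0r.
Qed.

Lemma bump_shift (c : R) a : bump a -> bump (fun t => a (t + c)).
Proof.
move=> [sa [r r0 ar]]; split.
  move=> n; have := Cn_affine 1 c (sa n); congr Cn.
  by apply/funext => t; rewrite mul1r.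
exists (r + `|c|) => [|t rt]; first by rewrite ltr_wpDr.
apply: ar; have := lerB_normD t c; lra.
Qed.

Lemma derive1_eq0 a (x : R) : (\near x, a x = 0) -> derive1 a x = 0.
Proof.
move=> ax; rewrite derive1E.
have [_ ->] : is_derive x 1 a 0; last by [].
by apply: (@near_eq_is_derive _ _ _ (fun=> 0)); near do apply/esym.
Unshelve. all: by end_near. Qed.

Lemma bump_derive1 a : bump a -> bump (derive1 a).
Proof.
move=> [sa [r r0 ar]]; split; first exact: smooth1_derive1.
exists (r + 1) => [|t rt]; first by rewrite addr_gt0.
apply: derive1_eq0; near=> s; apply: ar.
have : `|t - s| < 1 by near: s; exact: (@cvgr_dist_lt _ _ _ _ _ id).
have := ler_normB (t - s) t; rewrite addrAC subrr add0r normrN.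
have := ler_normD (t - s) s; rewrite subrK; lra.
Unshelve. all: by end_near. Qed.

Lemma bump_cutoff (r c : R) : 0 < r -> bump (cutoff r c).
Proof.
move=> r0; split; first exact: smooth1_cutoff.
exists (r + `|c|) => [|t rt]; first by rewrite ltr_wpDr.
by apply: cutoff_eq0 => //; have := lerB_dist t c; lra.
Qed.

Lemma bump_restrict a (r : R) : (forall t, r <= `|t| -> a t = 0) ->
  a \_ `[- r, r]%classic = a.
Proof.
move=> ar; apply/funext => t; rewrite patchE; case: ifPn => // /negP h.
rewrite ar// leNgt; apply/negP => tr; apply: h; rewrite inE/= in_itv/=.
by move: tr; rewrite ltr_norml => /andP[/ltW-> /ltW->].
Qed.

Lemma bump_integrable a : bump a -> mu.-integrable setT (EFin \o a).
Proof.
move=> [sa [r r0 ar]].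
have : mu.-integrable `[- r, r]%classic (EFin \o a).
  apply: continuous_compact_integrable; first exact: segment_compact.
  by apply: continuous_subspaceT; exact: smooth1_continuous.
rewrite integrable_mkcond//.
by rewrite restrict_EFin bump_restrict.
Qed.

Lemma integral_derive1_bump a : bump a -> \int[mu]_t derive1 a t = 0.
Proof.
move=> ba; have [_ [r r0 ar']] := bump_derive1 ba.
have [sa [q q0 aq]] := ba.
pose s := Num.max r q.
have s0 : 0 < s by rewrite lt_max r0.
rewrite -(@bump_restrict (derive1 a) s); last first.
  by move=> t st; apply: ar'; rewrite (le_trans _ st)// le_max lexx.
rewrite -Rintegral_mkcond /Rintegral (@continuous_FTC2 _ _ a).
- have as0 : a s = 0 by apply: aq; rewrite gtr0_norm// le_max lexx orbT.
  have ams0 : a (- s) = 0 by apply: aq; rewrite normrN gtr0_norm// le_max lexx orbT.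
  by rewrite as0 ams0 sube0.
- by lra.
- apply: continuous_subspaceT; apply: smooth1_continuous; exact: smooth1_derive1.
- have ca := smooth1_continuous sa; split.
  + by move=> x _; have [] := sa 1%N.
  + by apply: cvg_at_right_filter; exact: ca.
  + by apply: cvg_at_left_filter; exact: ca.
- by [].
Qed.

Lemma Cn_trig n (f : R -> R) : f = sin \/ f = cos -> forall c : R, Cn n (fun t => c * f t).
Proof.
elim: n f => [//|n IH] f [->|->] c.
  apply: (@CnS_is_derive _ _ _ (fun t => c * cos t)); last by apply: IH; right.
apply: (@CnS_is_derive _ _ _ (fun t => (- c) * sin t)); last by apply: IH; left.
  by move=> x; apply: is_derive_eq; rewrite /GRing.scale/=; ring.
Qed.

Lemma smooth1_cosZ (w : R) : smooth1 (fun t => cos (w * t)).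
Proof.
move=> n; have := Cn_affine w 0 (Cn_trig n (or_intror erefl) 1); congr Cn.
by apply/funext => t; rewrite mul1r addr0.
Qed.

Lemma smooth1_sinZ (w : R) : smooth1 (fun t => sin (w * t)).
Proof.
move=> n; have := Cn_affine w 0 (Cn_trig n (or_introl erefl) 1); congr Cn.
by apply/funext => t; rewrite mul1r addr0.
Qed.

End Bumps.

(** * Fourier transform on the line *)

Section FourierLine.
Context {R : realType}.
Local Notation mu := (@lebesgue_measure R).
Implicit Types a b : R -> R.

Definition wave a (y t : R) : R[i] := ((a t)%:C)%C * expi (- (2 * pi * (y * t))).

Definition ft a (y : R) : R[i] := cintegral mu (wave a y).

Lemma Re_wave a y t : complex.Re (wave a y t) = a t * cos (- (2 * pi * y) * t).
Proof. by rewrite /wave ReM/= mul0r subr0 mulNr !mulrA. Qed.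

Lemma Im_wave a y t : complex.Im (wave a y t) = a t * sin (- (2 * pi * y) * t).
Proof. by rewrite /wave ImM/= mul0r addr0 mulNr !mulrA. Qed.

Lemma bump_cos a (w : R) : bump a -> bump (fun t => a t * cos (w * t)).
Proof. by move=> ba; apply: bumpM => //; exact: smooth1_cosZ. Qed.

Lemma bump_sin a (w : R) : bump a -> bump (fun t => a t * sin (w * t)).
Proof. by move=> ba; apply: bumpM => //; exact: smooth1_sinZ. Qed.

Lemma cintegrable_wave a y : bump a -> cintegrable mu (wave a y).
Proof.
move=> ba; split.
  have -> : (fun x => complex.Re (wave a y x)) = (fun t => a t * cos (- (2 * pi * y) * t)).
    by apply/funext => t; rewrite Re_wave.
  by apply: bump_integrable; exact: bump_cos.
have -> : (fun x => complex.Im (wave a y x)) = (fun t => a t * sin (- (2 * pi * y) * t)).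
  by apply/funext => t; rewrite Im_wave.
by apply: bump_integrable; exact: bump_sin.
Qed.

Lemma ftE a y : ft a y =
  ((\int[mu]_t (a t * cos (- (2 * pi * y) * t))) +i*
   (\int[mu]_t (a t * sin (- (2 * pi * y) * t))))%C.
Proof.
rewrite /ft /cintegral; congr (_ +i* _)%C; apply: eq_Rintegral => t _.
  by rewrite Re_wave.
by rewrite Im_wave.
Qed.

(** Used with [f] the sine and the cosine, to show that transforms are measurable. *)
Lemma continuous_fourier_part a (f : R -> R) : bump a -> continuous f ->
  (forall t, `|f t| <= 1) ->
  continuous (fun y => \int[mu]_t (a t * f (- (2 * pi * y) * t))).
Proof.
move=> ba cf f1 y.
have ia := bump_integrable ba.
have cy (z : R) : continuous (fun t => f (- (2 * pi * z) * t)).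
  move=> t; apply: (@continuous_comp _ _ _ (fun t => - (2 * pi * z) * t) f); last exact: cf.
  by apply: cvgM; [exact: cvg_cst|exact: cvg_id].
have := @continuity_under_integral R _ _ mu (fun y t => a t * f (- (2 * pi * y) * t))
  setT measurableT (y - 1) (y + 1).
move=> /(_ _ _ (fun t => `|a t|)); apply.
- move=> z _.
  apply: (@le_integrable _ _ _ mu setT measurableT _ (EFin \o (fun t => `|a t|))).
  + apply/measurable_EFinP; apply: measurable_funM.
      by apply/measurable_EFinP; exact: measurable_int ia.
    exact: continuous_measurable_fun (cy z).
  + by move=> t _ /=; rewrite lee_fin normrM normr_id ler_piMr.
  + exact: integrable_norm.
- apply: aeW => t _ z _.
  apply: cvgM; first exact: cvg_cst.
  apply: (@continuous_comp _ _ _ (fun z : R => - (2 * pi * z) * t) f); last exact: cf.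
  apply: cvgM; last exact: cvg_cst.
  by apply: cvgN; apply: cvgM; [exact: cvg_cst|exact: cvg_id].
- exact: integrable_norm.
- by move=> z _; apply: aeW => t _; rewrite normrM ler_piMr.
- by rewrite inE/= in_itv/= ltrBlDr !ltrDl ltr01.
Qed.

Lemma cmeasurable_ft a : bump a -> cmeasurable (ft a).
Proof.
move=> ba; split.
  under eq_fun do rewrite ftE/=.
  apply: continuous_measurable_fun; apply: continuous_fourier_part => //.
    exact: continuous_cos.
  exact: cos_max.
under eq_fun do rewrite ftE/=.
apply: continuous_measurable_fun; apply: continuous_fourier_part => //.
  exact: continuous_sin.
exact: sin_max.
Qed.

Lemma derive1M (f g : R -> R) (t df dg : R) : is_derive t 1 f df -> is_derive t 1 g dg ->
  derive1 (fun t => f t * g t) t = f t * dg + g t * df.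
Proof. by move=> hf hg; rewrite derive1E; have [_ ->] := is_deriveM hf hg. Qed.

(** Integration by parts, in the form: the derivatives of a(t) cos(wt) and of a(t) sin(wt)
    have integral 0. *)
Lemma ft_derive1 a y : bump a ->
  ft (derive1 a) y = (0 +i* (2 * pi * y))%C * ft a y.
Proof.
move=> ba; have bd := bump_derive1 ba; rewrite !ftE; simpc.
set w := - (2 * pi * y).
have Rz (h : R -> R) (c : R) : bump h -> \int[mu]_t (c * h t) = c * \int[mu]_t h t.
  by move=> bh; rewrite RintegralZl//; exact: bump_integrable.
have iZ (h : R -> R) (c : R) : bump h -> mu.-integrable setT (EFin \o (fun t => c * h t)).
  by move=> bh; exact: (integrableZl measurableT c (bump_integrable bh)).
have dw (t : R) : is_derive t 1 (fun t : R => w * t) w.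
  by apply: is_derive_eq; rewrite /GRing.scale/= mulr1.
have dcos (t : R) : is_derive t 1 (fun t : R => cos (w * t)) (- sin (w * t) * w).
  exact: (@is_derive1_comp R cos (fun t => w * t) t _ _ (is_derive_cos _) (dw t)).
have dsin (t : R) : is_derive t 1 (fun t : R => sin (w * t)) (cos (w * t) * w).
  exact: (@is_derive1_comp R sin (fun t => w * t) t _ _ (is_derive_sin _) (dw t)).
have da (t : R) : is_derive t 1 a (derive1 a t) by apply: smooth1_is_derive; case: ba.
have hc : \int[mu]_t (derive1 a t * cos (w * t)) = w * \int[mu]_t (a t * sin (w * t)).
  apply/eqP; rewrite -subr_eq0 -Rz; last exact: bump_sin.
  rewrite -RintegralB//; last first.
  - by apply: iZ; exact: bump_sin.
  - by apply: bump_integrable; exact: bump_cos.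
  rewrite -(integral_derive1_bump (bump_cos w ba)); apply/eqP; apply: eq_Rintegral => t _.
  by rewrite (derive1M (da t) (dcos t)); ring.
have hs : \int[mu]_t (derive1 a t * sin (w * t)) = - w * \int[mu]_t (a t * cos (w * t)).
  apply/eqP; rewrite -subr_eq0 -Rz; last exact: bump_cos.
  rewrite -RintegralB//; last first.
  - by apply: iZ; exact: bump_cos.
  - by apply: bump_integrable; exact: bump_sin.
  rewrite -(integral_derive1_bump (bump_sin w ba)); apply/eqP; apply: eq_Rintegral => t _.
  by rewrite (derive1M (da t) (dsin t)); ring.
by rewrite hc hs /w opprK mulNr.
Qed.

(** By [ft_derive1], each factor [`|y|] can be traded for a derivative of the bump. *)
Lemma ft_decay a (M : nat) : bump a ->
  exists2 C : R, 0 <= C & forall y, `|y| ^+ M * cabs (ft a y) <= C.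
Proof.
elim: M a => [|M IH] a ba.
  exists (\int[mu]_t (2 * `|a t|)).
    by apply: Rintegral_ge0 => t _; rewrite mulr_ge0.
  move=> y; rewrite mul1r; have iw := cintegrable_wave y ba.
  rewrite (le_trans (cabs_cintegral iw))//; apply: le_Rintegral => //.
  - exact: cintegrable_cabs.
  - exact: (integrableZl measurableT 2 (integrable_norm (bump_integrable ba))).
  - move=> t _; rewrite (le_trans (cabsM _ _))// mulrC ler_pM ?cabs_ge0//.
      exact: cabs_expi.
    by rewrite /cabs/= normr0 addr0.
have [C C0 hC] := IH _ (bump_derive1 ba).
have p0 : 0 < 2 * pi :> R by rewrite mulr_gt0// pi_gt0.
exists (C / (2 * pi)) => [|y]; first by rewrite divr_ge0// ltW.
rewrite ler_pdivlMr//; apply: le_trans (hC y); rewrite ft_derive1//.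
have -> : cabs ((0 +i* (2 * pi * y))%C * ft a y) = 2 * pi * `|y| * cabs (ft a y).
  case: (ft a y) => u v; rewrite /cabs; simpc => /=.
  by rewrite normrN !normrM (gtr0_norm (pi_gt0 R)) (@gtr0_norm _ 2)//; ring.
by rewrite exprS le_eqVlt; apply/orP; left; apply/eqP; ring.
Qed.

Lemma ft_shift a (c y : R) : bump a ->
  ft (fun t => a (t + c)) y = expi (2 * pi * (c * y)) * ft a y.
Proof.
move=> ba; rewrite /ft -cintegralZ; last exact: cintegrable_wave.
have [_ <-] := cintegral_shift c (cintegrableZ (expi (2 * pi * (c * y))) (cintegrable_wave y ba)).
apply: eq_cintegral => t; rewrite /wave [RHS]mulrCA -expiD; congr (_ * expi _); ring.
Qed.

End FourierLine.

(** * Euclidean norm and balls *)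

Section EuclideanFacts.
Context {R : realType} {d : nat}.
Implicit Types x y : 'rV[R]_d.

Lemma enorm_ge0 x : 0 <= enorm x. Proof. exact: sqrtr_ge0. Qed.

Lemma coord_le_enorm x i : `|x 0 i| <= enorm x.
Proof.
rewrite -sqrtr_sqr ler_wsqrtr// /dotprod (bigD1 i)//= -expr2 lerDl.
by apply: sumr_ge0 => j _; rewrite -expr2 sqr_ge0.
Qed.

Lemma enorm_le x (b : R) : 0 <= b -> (forall i, `|x 0 i| <= b) -> enorm x <= d%:R * b.
Proof.
move=> b0 xb; rewrite -[leRHS]ger0_norm ?mulr_ge0// -sqrtr_sqr ler_wsqrtr//.
rewrite /dotprod exprMn (@le_trans _ _ (\sum_(i < d) b ^+ 2))//.
  by apply: ler_sum => i _; rewrite -expr2 -real_normK ?num_real// lerXn2r ?nnegrE.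
rewrite sumr_const card_ord -[leLHS]mulr_natl ler_wpM2r ?sqr_ge0//.
by case: d => [|n]; rewrite ?expr0n// -natrX ler_nat leq_pmulr.
Qed.

Lemma dotprod_le x y : `|dotprod x y| <= (\sum_(i < d) `|x 0 i|) * enorm y.
Proof.
rewrite (le_trans (ler_norm_sum _ _ _))// mulr_suml; apply: ler_sum => i _.
by rewrite normrM ler_wpM2l// coord_le_enorm.
Qed.

Lemma measurable_enorm : measurable_fun setT (@enorm R d).
Proof.
apply: (@measurableT_comp _ _ _ _ _ _ (@Num.sqrt R)).
  by apply: continuous_measurable_fun; exact: sqrt_continuous.
apply: measurable_sum => i.
by apply: measurable_funM; exact: measurable_fun_coord.
Qed.

Lemma measurable_eball x (r : R) : measurable (eball x r).
Proof.
have h : measurable_fun setT (fun y => enorm (y - x)).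
  apply: (measurableT_comp measurable_enorm); apply: measurable_fun_rV => i.
  under eq_fun do rewrite !mxE.
  by apply: measurable_funD => //; exact: measurable_fun_coord.
have -> : eball x r = (fun y => enorm (y - x)) @^-1` `]-oo, r].
  by apply/seteqP; split => y /=; rewrite in_itv/=.
by rewrite -[X in measurable X]setTI; exact: h.
Qed.

End EuclideanFacts.

(** * Integrability against a measure of polynomial growth *)

Section Growth.
Context {R : realType} {d : nat} (nu : {measure set 'rV[R]_d -> \bar R}).
Variables (N : nat) (C : R).
Hypothesis nuC : forall r : R, 1 <= r -> (nu (eball 0 r) <= (C * r ^+ N)%:E)%E.

(* The weight [W] sums the indicators of the dyadic balls with coefficients c n that beat
   the growth of [nu]: the n-th term has integral at most C 2^(-n). *)
Let c (n : nat) : R := (2^-1 ^+ N.+1) ^+ n.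

Let c_gt0 n : 0 < c n. Proof. by rewrite !exprn_gt0// invr_gt0. Qed.

Let w (n : nat) (y : 'rV[R]_d) : \bar R := (c n * \1_(eball 0 (2 ^+ n)) y)%:E.

Let W (y : 'rV[R]_d) : \bar R := (\sum_(n <oo) w n y)%E.

Let w_ge0 n y : (0 <= w n y)%E.
Proof. by rewrite lee_fin mulr_ge0// ltW. Qed.

Let measurable_w n : measurable_fun setT (w n).
Proof.
apply/measurable_EFinP; apply: measurable_funM => //.
by apply: measurable_indic; exact: measurable_eball.
Qed.

Let measurable_W : measurable_fun setT W.
Proof. exact: ge0_emeasurable_sum. Qed.

Let integral_W : (\int[nu]_y W y < +oo)%E.
Proof.
rewrite integral_nneseries//.
have C0 : 0 <= C.
  have := nuC (lexx 1); rewrite expr1n mulr1 => h.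
  by rewrite -lee_fin (le_trans _ h).
apply: (@le_lt_trans _ _ (\sum_(n <oo) (2 * C / (2 ^ n.+1)%:R)%:E)%E); last first.
  rewrite (le_lt_trans (epsilon_trick0 _ _))//; last by rewrite ltry.
  by rewrite mulr_ge0.
apply: lee_nneseries => [n _ _|n _]; first by apply: integral_ge0 => y _; exact: w_ge0.
rewrite /w; under eq_integral do rewrite EFinM.
rewrite ge0_integralZl//; first last.
- by rewrite lee_fin ltW.
- by apply/measurable_EFinP; apply: measurable_indic; exact: measurable_eball.
rewrite integral_indic//; last exact: measurable_eball.
rewrite setIT (@le_trans _ _ ((c n)%:E * (C * (2 ^+ n) ^+ N)%:E)%E)//.
  by rewrite lee_wpmul2l ?lee_fin ?(ltW (c_gt0 _))//; apply: nuC; rewrite exprn_ege1// ler1n.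
rewrite -EFinM lee_fin /c -!exprM natrX mulSn exprD (exprS 2 n).
rewrite le_eqVlt; apply/orP; left; apply/eqP.
rewrite mulnC !exprVn; field.
by rewrite !expf_neq0.
Qed.

(** Outside the dyadic ball of radius 2^k, the hypotheses bound [f] by a multiple of the
    next term of the weight, so that [f] is dominated by the weight. *)
Lemma growth_integrable (f : 'rV[R]_d -> R) (K : R) : measurable_fun setT f ->
  (forall y, `|f y| <= K) -> (forall y, enorm y ^+ N.+1 * `|f y| <= K) ->
  nu.-integrable setT (EFin \o f).
Proof.
move=> mf fK fNK.
have K0 : 0 <= K by exact: le_trans (normr_ge0 _) (fK 0).
apply/integrableP; split; first exact/measurable_EFinP.
pose A := K * 2 ^+ N.+1.
have A0 : 0 <= A by rewrite mulr_ge0// exprn_ge0.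
apply: (@le_lt_trans _ _ (\int[nu]_y (A%:E * W y))%E); last first.
  rewrite ge0_integralZl//; last by move=> y _; exact: nneseries_ge0.
  by rewrite lte_mul_pinfty.
apply: ge0_le_integral => //.
- by apply: measurableT_comp => //; exact/measurable_EFinP.
- exact: measurable_funeM.
move=> y _ /=.
have [n yn] : exists n, enorm y <= 2 ^+ n.
  exists (Num.truncn (enorm y)).+1; rewrite (le_trans (ltW (truncnS_gt _)))//.
  by rewrite -natrX ler_nat ltnW// ltn_expl.
(* The first dyadic ball that contains y. *)
pose m := ex_minn (ex_intro (fun n => enorm y <= 2 ^+ n) n yn).
have [ym mmin] : enorm y <= 2 ^+ m /\ forall k, enorm y <= 2 ^+ k -> (m <= k)%N.
  by rewrite /m; case: ex_minnP.
apply: (@le_trans _ _ (A%:E * w m y)%E); last first.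
  rewrite lee_wpmul2l// /W.
  rewrite (le_trans _ (@nneseries_lim_ge _ _ xpredT 0 m.+1 _))//.
  by rewrite big_mkord big_ord_recr/= leeDr// sume_ge0.
rewrite -EFinM lee_fin indicE mem_set; last by rewrite /eball/= subr0.
rewrite mulr1 /A.
case: (m) mmin => [|k] kmin.
  rewrite /c expr0 mulr1 (le_trans (fK y))// ler_peMr//.
  by rewrite exprn_ege1// ler1n.
have yk : 2 ^+ k <= enorm y.
  by rewrite leNgt; apply/negP => /ltW/kmin; rewrite ltnn.
have -> : K * 2 ^+ N.+1 * c k.+1 = K / (2 ^+ k) ^+ N.+1.
  have -> : c k.+1 = (2 ^+ N.+1)^-1 * ((2 ^+ k) ^+ N.+1)^-1.
    by rewrite /c !exprVn exprS invfM [in RHS]exprAC.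
  by rewrite mulrA mulfK// expf_neq0.
rewrite ler_pdivlMr ?exprn_gt0// mulrC (le_trans _ (fNK y))//.
by rewrite ler_wpM2r// lerXn2r ?nnegrE// ?exprn_ge0// enorm_ge0.
Qed.

Lemma growth_finite (r : R) : (nu (eball 0 r) < +oo)%E.
Proof.
apply: (@le_lt_trans _ _ (nu (eball 0 (Num.max 1 r)))).
  apply: le_measure; rewrite ?inE; [exact: measurable_eball..|].
  by move=> y yr; apply: (le_trans yr); rewrite le_max lexx orbT.
by rewrite (le_lt_trans (nuC _)) ?ltry// le_max lexx.
Qed.

Lemma growth_sigma_finite : sigma_finite setT nu.
Proof.
exists (fun n => eball 0 n%:R) => [|n]; last first.
  by split; [exact: measurable_eball|exact: growth_finite].
apply/esym; rewrite -subTset => y _; exists (Num.truncn (enorm y)).+1 => //=.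
by rewrite /eball/= subr0 ltW// truncnS_gt.
Qed.

End Growth.

(** * Fourier transform of products of bumps *)

Section Tensor.
Context {R : realType} {d : nat}.
Implicit Types (a : 'I_d -> R -> R) (x y : 'rV[R]_d).

Definition rprod a x : R := \prod_(i < d) a i (x 0 i).

Definition tensor a x : R[i] := ((rprod a x)%:C)%C.

Definition bumps a : Prop := forall i, bump (a i).

Lemma tensorE a x : tensor a x = \prod_(i < d) ((a i (x 0 i))%:C)%C.
Proof. by rewrite /tensor /rprod rmorph_prod. Qed.

Lemma tensor_wave a y x : tensor a x * expi (- (2 * pi * dotprod y x)) =
  cprod (fun i => wave (a i) (y 0 i)) x.
Proof.
rewrite tensorE /cprod /wave big_split/= -expi_sum; congr (_ * expi _).
by rewrite /dotprod mulr_sumr sumrN.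
Qed.

Lemma cintegrable_tensor_wave a y : bumps a ->
  cintegrable (lebesgue_rV d) (fun x => tensor a x * expi (- (2 * pi * dotprod y x))).
Proof.
move=> ba; have [int _] := cintegral_cprod (fun i => cintegrable_wave (y 0 i) (ba i)).
have -> // : (fun x => tensor a x * expi (- (2 * pi * dotprod y x))) =
  cprod (fun i => wave (a i) (y 0 i)) by apply/funext => x; rewrite tensor_wave.
Qed.

Lemma fourier_tensor a : bumps a -> fourier (tensor a) = cprod (fun i => ft (a i)).
Proof.
move=> ba; apply/funext => y; rewrite /fourier.
have [_ e] := cintegral_cprod (fun i => cintegrable_wave (y 0 i) (ba i)).
by rewrite (eq_cintegral _ (tensor_wave a y)).
Qed.

Lemma cmeasurable_fourier_tensor a : bumps a -> cmeasurable (fourier (tensor a)).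
Proof.
by move=> ba; rewrite fourier_tensor//; apply: cmeasurable_cprod => i; exact: cmeasurable_ft.
Qed.

Lemma fourier_tensor_shift a (c y : 'rV[R]_d) : bumps a ->
  fourier (tensor (fun i t => a i (t + c 0 i))) y =
  expi (2 * pi * dotprod c y) * fourier (tensor a) y.
Proof.
move=> ba; rewrite !fourier_tensor//; last by move=> i; exact: bump_shift.
rewrite /cprod mulr_sumr expi_sum -big_split/=; apply: eq_bigr => i _.
by rewrite ft_shift.
Qed.

Lemma cabs_prod (I : Type) (s : seq I) (P : pred I) (z : I -> R[i]) :
  cabs (\prod_(i <- s | P i) z i) <= \prod_(i <- s | P i) cabs (z i).
Proof.
elim/big_rec2 : _ => [|i u v _ uv]; first by rewrite /cabs/= normr1 normr0 addr0.
by rewrite (le_trans (cabsM _ _))// ler_wpM2l// cabs_ge0.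
Qed.

(** All the factors are bounded, and the factor of the coordinate of [y] that is largest in
    absolute value decays like any power of [enorm y]. *)
Lemma fourier_tensor_decay a (M : nat) : bumps a -> (0 < d)%N ->
  exists K : R, forall y, enorm y ^+ M * cabs (fourier (tensor a) y) <= K.
Proof.
move=> ba d0; rewrite fourier_tensor//.
have /choice[C0 C0P] : forall i : 'I_d, exists C : R, 0 <= C /\ forall t, cabs (ft (a i) t) <= C.
  move=> i; have [C C0 h] := ft_decay 0 (ba i); exists C; split=> // t.
  by have := h t; rewrite mul1r.
have /choice[CM CMP] : forall i : 'I_d, exists C : R, 0 <= C /\
    forall t, `|t| ^+ M * cabs (ft (a i) t) <= C.
  by move=> i; have [C C0' h] := ft_decay M (ba i); exists C.
pose K i := CM i * \prod_(j < d | j != i) C0 j.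
have K0 i : 0 <= K i.
  by rewrite mulr_ge0 ?(CMP i).1//; apply: prodr_ge0 => j _; exact: (C0P j).1.
exists (d%:R ^+ M * \sum_(i < d) K i) => y.
pose i := [arg max_(i > Ordinal d0) `|y 0 i|]%O.
have yi j : `|y 0 j| <= `|y 0 i|.
  by rewrite /i; case: arg_maxP => //= k _; exact.
have yle : enorm y ^+ M <= d%:R ^+ M * `|y 0 i| ^+ M.
  rewrite -exprMn lerXn2r ?nnegrE ?mulr_ge0 ?enorm_ge0//.
  exact: enorm_le.
rewrite (@le_trans _ _ (d%:R ^+ M * `|y 0 i| ^+ M * cabs (cprod (fun i => ft (a i)) y)))//.
  by rewrite ler_wpM2r// cabs_ge0.
rewrite -mulrA ler_wpM2l ?exprn_ge0//.
rewrite (@le_trans _ _ (K i))//; last first.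
  by rewrite (bigD1 i)//= lerDl sumr_ge0.
rewrite (@le_trans _ _ (`|y 0 i| ^+ M * \prod_(j < d) cabs (ft (a j) (y 0 j))))//.
  by rewrite ler_wpM2l ?exprn_ge0//; exact: cabs_prod.
rewrite (bigD1 i)//= mulrA /K ler_pM//.
- by rewrite mulr_ge0 ?exprn_ge0 ?cabs_ge0.
- by apply: prodr_ge0 => j _; exact: cabs_ge0.
- exact: (CMP i).2.
- by apply: ler_prod => j _; rewrite cabs_ge0 (C0P j).2.
Qed.

Variables (nu : {measure set 'rV[R]_d -> \bar R}).

Lemma tempered_cintegrable_fourier a : tempered nu -> (0 < d)%N -> bumps a ->
  cintegrable nu (fourier (tensor a)).
Proof.
move=> [_ [N [C _ nuC]]] d0 ba.
have [K0 hK0] := fourier_tensor_decay 0 ba d0.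
have [K1 hK1] := fourier_tensor_decay N.+1 ba d0.
have mF := cmeasurable_fourier_tensor ba.
apply: (@le_cintegrable _ _ _ _ _ (fun y => cabs (fourier (tensor a) y))) => //.
apply: (@growth_integrable _ _ _ N C nuC _ (Num.max K0 K1)).
- exact: cmeasurable_cabs.
- move=> y; have := hK0 y; rewrite mul1r ger0_norm ?cabs_ge0// le_max => ->//.
- by move=> y; have := hK1 y; rewrite ger0_norm ?cabs_ge0// le_max => ->; rewrite orbT.
Qed.

End Tensor.

(** * Products of bumps as test functions *)

Section TestFunctions.
Context {R : realType} {d : nat}.
Implicit Types (a : 'I_d -> R -> R) (x y c : 'rV[R]_d).

Lemma continuous_rprod a : (forall i, smooth1 (a i)) -> continuous (rprod a).
Proof.
move=> sa.
pose g (s : seq 'I_d) : 'rV[R]_d -> R := fun x => \prod_(i <- s) a i (x 0 i).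
suff h s : continuous (g s) by exact: h.
elim: s => [|i s IH].
  have -> : g [::] = cst 1 by apply/funext => y; rewrite /g big_nil.
  exact: cst_continuous.
have -> : g (i :: s) = (a i \o (fun y : 'rV[R]_d => y 0 i)) \* g s.
  by apply/funext => y; rewrite /g big_cons.
move=> x; apply: continuousM; last exact: IH.
apply: continuous_comp; first exact: coord_continuous.
exact: smooth1_continuous.
Qed.

Lemma is_derive_rprod a i x : (forall i, smooth1 (a i)) ->
  is_derive x 'e_i (rprod a)
    (rprod (fun j => if j == i then derive1 (a j) else a j) x).
Proof.
move=> sa; have dai : is_derive (x 0 i) 1 (a i) (derive1 (a i) (x 0 i)).
  exact: smooth1_is_derive.
pose Q := \prod_(j < d | j != i) a j (x 0 j).
have quot : (fun h : R => h^-1 *: ((rprod a \o shift x) (h *: 'e_i) - rprod a x)) =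
    (fun h : R => (h^-1 *: ((a i \o shift (x 0 i)) (h *: 1) - a i (x 0 i))) * Q).
  apply/funext => h /=; rewrite /rprod (bigD1 i)//= [X in _ - X](bigD1 i)//=.
  have -> : \prod_(j < d | j != i) a j ((h *: 'e_i + x) 0 j) = Q.
    apply: eq_bigr => j ji; rewrite !mxE eqxx/= (negbTE ji) mulr0 add0r//.
  by rewrite !mxE !eqxx /= -/Q /GRing.scale/= -mulrBl mulrA.
have cv : (fun h : R => h^-1 *: ((rprod a \o shift x) (h *: 'e_i) - rprod a x)) @ 0^' -->
    derive1 (a i) (x 0 i) * Q.
  rewrite quot; apply: cvgM; last exact: cvg_cst.
  by have [+ <-] := dai; exact.
have -> : rprod (fun j => if j == i then derive1 (a j) else a j) x =
    derive1 (a i) (x 0 i) * Q.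
  rewrite /rprod (bigD1 i)//= eqxx; congr (_ * _).
  by apply: eq_bigr => j /negbTE ->.
by apply: DeriveDef; [apply/cvg_ex; eexists; exact: cv|exact/cvg_lim].
Qed.

(** A partial derivative acts on a single factor, so the class of products is stable. *)
Lemma partial_rprod (s : seq 'I_d) a : (forall i, smooth1 (a i)) ->
  exists2 b, (forall i, smooth1 (b i)) & partial s (rprod a) = rprod b.
Proof.
move=> sa; elim: s => [|i s [b sb IH]]; first by exists a.
exists (fun j => if j == i then derive1 (b j) else b j).
  by move=> j; case: ifP => // _; exact: smooth1_derive1.
rewrite /= [X in derive X](_ : _ = rprod b)//; apply/funext => x.
by have [_ ->] := is_derive_rprod i x sb.
Qed.

Lemma smooth_rprod a : (forall i, smooth1 (a i)) -> smooth (rprod a).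
Proof.
move=> sa s; have [b sb ->] := partial_rprod s sa.
split; first exact: continuous_rprod.
by move=> i x; have [] := is_derive_rprod i x sb.
Qed.

Lemma smooth0 : smooth (fun _ : 'rV[R]_d => 0 : R).
Proof.
have p0 (s : seq 'I_d) : partial s (fun _ : 'rV[R]_d => 0 : R) = fun=> 0.
  elim: s => //= i s ->; apply/funext => x.
  by have [_ ->] := is_derive_cst (0 : R) x 'e_i.
move=> s; rewrite p0; split; first exact: cst_continuous.
by move=> i x; have [] := is_derive_cst (0 : R) x 'e_i.
Qed.

Definition box c (r : R) : set 'rV[R]_d := [set x | forall i, `|x 0 i - c 0 i| <= r].

Lemma box_compact c r : compact (box c r).
Proof.
have -> : box c r = [set v : 'rV[R]_d | forall i, `[c 0 i - r, c 0 i + r]%classic (v ord0 i)].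
  by apply/seteqP; split => v /= vr i; have := vr i; rewrite in_itv/= ler_distl.
by apply: (@rV_compact _ _ (fun i => `[c 0 i - r, c 0 i + r]%classic)) => i; exact: segment_compact.
Qed.

(** Vanishing is asked factor by factor, which gives support in [box c r] even when all
    factors but one are nonzero. *)
Definition supported a c (r : R) : Prop :=
  forall i t, r < `|t - c 0 i| -> a i t = 0.

Lemma supported_box a c r x : supported a c r -> tensor a x != 0 -> box c r x.
Proof.
move=> sa xa i; rewrite leNgt; apply: contra xa => h; apply/eqP.
by rewrite tensorE (bigD1 i)//= sa// mul0r.
Qed.

Lemma test_tensor a c r (U : set 'rV[R]_d) : bumps a -> supported a c r ->
  box c r `<=` U -> test_function U (tensor a).
Proof.
move=> ba sa rU.
have sub : fun_support (tensor a) `<=` box c r.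
  have /closure_id -> : closed (box c r).
    exact: compact_closed (@box_compact c r).
  by apply: closure_subset => x /=; exact: supported_box.
split.
- by apply: smooth_rprod => i; have [] := ba i.
- exact: smooth0.
- apply: (subclosed_compact _ (@box_compact c r)) => //; exact: closed_closure.
- exact: subset_trans rU.
Qed.

Lemma open_box (U : set 'rV[R]_d) x : open U -> U x ->
  exists2 r, 0 < r & box x r `<=` U.
Proof.
move=> oU Ux; have /nbhs_ballP[e /= e0 eU] := open_nbhs_nbhs (conj oU Ux).
exists (e / 2) => [|y yr]; first by rewrite divr_gt0.
apply: eU; apply/rV_ballE => // i; rewrite distrC (le_lt_trans (yr i))//.
by rewrite ltr_pdivrMr// ltr_pMr// ltr1n.
Qed.

End TestFunctions.

(** * Vanishing of the transform of nu off its spectrum *)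

Section Vanishing.
Context {R : realType} {d : nat}.
Implicit Types (a : 'I_d -> R -> R) (x y c : 'rV[R]_d).
Variables (nu : {measure set 'rV[R]_d -> \bar R}).

(** The integrals of non-integrable functions have no meaning, so additivity of
    [fourier_measure nu] has to be restricted to such functions. *)
Definition transformable (f : 'rV[R]_d -> R[i]) : Prop :=
  (forall y, cintegrable (lebesgue_rV d)
     (fun x => f x * expi (- (2 * pi * dotprod y x)))) /\
  cintegrable nu (fourier f).

Lemma fourier_measureB f g : transformable f -> transformable g ->
  transformable (fun x => f x + (-1) * g x) /\
  fourier_measure nu (fun x => f x + (-1) * g x) =
  fourier_measure nu f - fourier_measure nu g.
Proof.
move=> [fl fn] [gl gn].
have e y : (fun x => (f x + (-1) * g x) * expi (- (2 * pi * dotprod y x))) =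
    (fun x => f x * expi (- (2 * pi * dotprod y x)) +
       (-1) * (g x * expi (- (2 * pi * dotprod y x)))).
  by apply/funext => x; rewrite mulrDl mulrA.
have fe : fourier (fun x => f x + (-1) * g x) =
    (fun y => fourier f y + (-1) * fourier g y).
  apply/funext => y; rewrite /fourier e cintegralD// ?cintegralZ//.
  exact: cintegrableZ.
split; first split.
- by move=> y; rewrite e; apply: cintegrableD => //; exact: cintegrableZ.
- by rewrite fe; apply: cintegrableD => //; exact: cintegrableZ.
- rewrite /fourier_measure fe cintegralD// ?cintegralZ// ?mulN1r//.
  exact: cintegrableZ.
Qed.

Hypotheses (tnu : tempered nu) (d0 : (0 < d)%N).

Lemma transformable_tensor a : bumps a -> transformable (tensor a).
Proof.
move=> ba; split; first by move=> y; exact: cintegrable_tensor_wave.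
exact: tempered_cintegrable_fourier.
Qed.

Lemma spec_local x : ~ spec nu x -> exists2 r, 0 < r &
  forall a, bumps a -> supported a x r -> fourier_measure nu (tensor a) = 0.
Proof.
move=> /contrapT[U [oU UT] Ux]; have [r r0 rU] := open_box oU Ux.
by exists r => // a ba sa; apply: UT; exact: test_tensor rU.
Qed.

Definition cutoffs (r : R) c (i : 'I_d) (t : R) : R := cutoff r (c 0 i) t.

(** Multiplying by 1 - c, where c is a cutoff whose support lies where the distribution
    vanishes locally, does not change its value: the difference is a product of bumps
    supported in that place.  This replaces a partition of unity, and needs only
    products and differences of cutoffs. *)
Lemma fourier_measure_partition (rho : 'rV[R]_d -> R) (l : seq 'rV[R]_d) :
  (forall c, c \in l -> 0 < rho c /\
    forall a, bumps a -> supported a c (rho c) -> fourier_measure nu (tensor a) = 0) ->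
  forall a, bumps a -> exists f, [/\ transformable f,
    fourier_measure nu f = fourier_measure nu (tensor a) &
    forall x, f x = tensor a x * \prod_(c <- l) (1 - tensor (cutoffs (rho c) c) x)].
Proof.
elim: l => [_ a ba|c l IH lP a ba].
  exists (tensor a); split => //; first exact: transformable_tensor.
  by move=> x; rewrite big_nil mulr1.
have [|rc cP] := lP c; first by rewrite inE eqxx.
have {}IH := IH (fun c' c'l => lP c' (mem_behead (s := c :: l) c'l)).
have bac : bumps (fun i t => a i t * cutoffs (rho c) c i t).
  by move=> i; apply: bumpM => //; exact: smooth1_cutoff.
have [f [tf fT fE]] := IH _ ba.
have [g [tg gT gE]] := IH _ bac.
have [tfg fgT] := fourier_measureB tf tg.
have gT0 : fourier_measure nu g = 0.
  rewrite gT; apply: (cP _ bac) => i t h.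
  rewrite /cutoffs (cutoff_eq0 rc (ltW h)).
  exact: mulr0.
exists (fun x => f x + (-1) * g x); split; first exact: tfg.
  apply: (etrans fgT).
  rewrite gT0.
  rewrite subr0.
  exact: fT.
move=> x; rewrite fE gE big_cons.
have -> : tensor (fun i t => a i t * cutoffs (rho c) c i t) x =
    tensor a x * tensor (cutoffs (rho c) c) x.
  by rewrite !tensorE -big_split/=; apply: eq_bigr => i _; rewrite rmorphM.
ring.
Qed.

(** Finitely many half-size boxes, on which the cutoffs are equal to 1, cover the support.
    Then the product of [tensor a] and of all the 1 - c is identically 0, and
    [fourier_measure_partition] applies. *)
Lemma fourier_measure_eq0 a c r : bumps a -> supported a c r ->
  (forall x, box c r x -> ~ spec nu x) -> fourier_measure nu (tensor a) = 0.
Proof.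
move=> ba sa rspec.
have /choice[rho rhoP] : forall x, exists rho, box c r x -> 0 < rho /\
    forall a, bumps a -> supported a x rho -> fourier_measure nu (tensor a) = 0.
  move=> x; have [xr|xr] := pselect (box c r x); last by exists 0.
  by have [rho rho0 h] := spec_local (rspec _ xr); exists rho.
have := @box_compact R d c r; rewrite compact_cover.
move=> /(_ _ (box c r) (fun x => ball x (rho x / 2))) [].
- by move=> x xr; apply: ball_open; rewrite divr_gt0//; case: (rhoP x xr).
- by move=> x xr; exists x => //; apply: ballxx; rewrite divr_gt0//; case: (rhoP x xr).
move=> D DB cov.
have [x xD|f [tf <- fE]] := @fourier_measure_partition rho (finmap.enum_fset D) _ _ ba.
  by apply: rhoP; have := DB _ xD; rewrite inE.
have -> : f = fun=> 0.
  apply/funext => x; rewrite fE; have [->|ax] := eqVneq (tensor a x) 0; first by rewrite mul0r.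
  have [z /= zD xz] := cov _ (supported_box sa ax).
  have zr : box c r z by have := DB _ zD; rewrite inE.
  have [rz _] := rhoP z zr.
  have c1 : tensor (cutoffs (rho z) z) x = 1.
    rewrite tensorE big1// => i _; rewrite /cutoffs cutoff_eq1//.
    have rz2 : 0 < rho z / 2 by rewrite divr_gt0.
    by move/(rV_ballE _ _ rz2) : xz => /(_ i); rewrite distrC => /ltW.
  by rewrite (big_rem z)//= c1 subrr mul0r mulr0.
rewrite /fourier_measure (_ : fourier _ = fun=> 0) ?cintegral0//.
apply/funext => y; rewrite /fourier (_ : (fun x => _) = fun=> 0) ?cintegral0//.
by apply/funext => x; rewrite mul0r.
Qed.

End Vanishing.

(** * Power spectra are orthogonal to the characters off the spectrum *)

Section SigmaFinitePack.
Context {R : realType} {dT : measure_display} {T : measurableType dT}.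
Variables (nu : {measure set T -> \bar R}) (sf : sigma_finite setT nu).

(** A copy of [nu] that carries the sigma-finite structure, as Fubini demands. *)
Definition sigma_finite_pack of sigma_finite setT nu : set T -> \bar R := nu.

HB.instance Definition _ := Measure.copy (sigma_finite_pack sf) nu.

HB.instance Definition _ := Measure_isSigmaFinite.Build _ _ _
  (sigma_finite_pack sf) sf.

End SigmaFinitePack.

Section Autocorrelation.
Context {R : realType} {d : nat}.
Implicit Types (a : 'I_d -> R -> R) (x y p : 'rV[R]_d).

Lemma dotprodNl x y : dotprod (- x) y = - dotprod x y.
Proof. by rewrite /dotprod -sumrN; apply: eq_bigr => i _; rewrite mxE mulNr. Qed.

Lemma dotprodC x y : dotprod x y = dotprod y x.
Proof. by apply: eq_bigr => i _; rewrite mulrC. Qed.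

Lemma dotprodDl x x' y : dotprod (x + x') y = dotprod x y + dotprod x' y.
Proof. by rewrite /dotprod -big_split; apply: eq_bigr => i _; rewrite mxE mulrDl. Qed.

Lemma measurable_dotprod {dT : measure_display} {T : measurableType dT}
    (f g : T -> 'rV[R]_d) : measurable_fun setT f -> measurable_fun setT g ->
  measurable_fun setT (fun t => dotprod (f t) (g t)).
Proof.
move=> mf mg; apply: measurable_sum => i; apply: measurable_funM.
  exact: (measurableT_comp (measurable_fun_coord i) mf).
exact: (measurableT_comp (measurable_fun_coord i) mg).
Qed.

Lemma fourier_tensorN a y : bumps a -> fourier (tensor a) (- y) =
  (complex.Re (fourier (tensor a) y) -i* complex.Im (fourier (tensor a) y))%C.
Proof.
move=> ba; rewrite /fourier /cintegral.
have e x : tensor a x * expi (- (2 * pi * dotprod (- y) x)) =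
    (complex.Re (tensor a x * expi (- (2 * pi * dotprod y x))) -i*
     complex.Im (tensor a x * expi (- (2 * pi * dotprod y x))))%C.
  rewrite dotprodNl /tensor /expi mulrN !cosN !sinN; simpc; rewrite /=.
  by congr (_ +i* _)%C; ring.
have [_ ii] := cintegrable_tensor_wave y ba.
congr (_ +i* _)%C; first by apply: eq_Rintegral => x _; rewrite e.
rewrite [X in (- X)%R]/=.
rewrite -[RHS]mulN1r -RintegralZl//; apply: eq_Rintegral => x _.
by rewrite e mulN1r.
Qed.

Definition power_spectrum a y : R := abs2 (fourier (tensor a) y).

Lemma power_spectrumE a y : bumps a ->
  ((power_spectrum a y)%:C)%C = fourier (tensor a) y * fourier (tensor a) (- y).
Proof.
by move=> ba; rewrite fourier_tensorN// /power_spectrum abs2E.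
Qed.

Variables (nu : {measure set 'rV[R]_d -> \bar R}).
Hypotheses (tnu : tempered nu) (d0 : (0 < d)%N).

(** Instead of the autocorrelation of the bump, whose smoothness would have to be proved,
    its superposition of translates is used.  The function
    F (x, y) = psi(x) psi^(y) e(<x - p, y>) is integrated in both orders.  For fixed x in the
    support of psi, the integral in y is psi(x) times the value of the transform of [nu] on
    psi translated by p - x, which lives off the spectrum.  For fixed y, the integral in x
    is psi^(y) psi^(-y) e(-<p, y>), that is G(y) e(-<p, y>). *)
Lemma power_spectrum_orthogonal a p (r : R) : bumps a -> supported a 0 r ->
  (forall x, box p (2 * r) x -> ~ spec nu x) ->
  cintegral nu (fun y => ((power_spectrum a y)%:C)%C * expi (- (2 * pi * dotprod p y))) = 0.
Proof.
move=> ba sa pspec.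
have [[N [C C0 nuC]] P_int] := (tnu.2, tempered_cintegrable_fourier tnu d0 ba).
pose nu' : {sigma_finite_measure set 'rV[R]_d -> \bar R} :=
  sigma_finite_pack (growth_sigma_finite nuC).
set P := fourier (tensor a) in P_int *.
have tensor_int : cintegrable (lebesgue_rV d) (tensor a).
  have := cintegrable_tensor_wave 0 ba; congr cintegrable; apply/funext => x.
  rewrite /dotprod big1 ?mulr0 ?oppr0 ?expi0 ?mulr1// => i _.
  by rewrite mxE mul0r.
have cE f : cintegral nu f = cintegral nu' f by [].
have iE f : cintegrable nu f -> cintegrable nu' f by [].
pose F (q : 'rV[R]_d * 'rV[R]_d) : R[i] :=
  (tensor a q.1 * P q.2) * expi (2 * pi * dotprod (q.1 - p) q.2).
have mexp (dT : measure_display) (T : measurableType dT) (f g : T -> 'rV[R]_d) :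
    measurable_fun setT f -> measurable_fun setT g ->
    cmeasurable (fun t => expi (2 * pi * dotprod (f t - p) (g t))).
  move=> mf mg; apply: cmeasurable_expi; apply: measurable_funM => //.
  apply: measurable_dotprod => //; apply: measurable_fun_rV => i.
  under eq_fun do rewrite !mxE.
  by apply: measurable_funD => //; exact: (measurableT_comp (measurable_fun_coord i) mf).
have F_int : cintegrable (lebesgue_rV d \x nu')%E F.
  apply: (cintegrableM_bounded (M := 2)).
  - by apply: cintegrableX => //; exact: iE.
  - exact: mexp.
  - by move=> q; exact: cabs_expi.
have F1 x : cintegrable nu' (fun y => F (x, y)).
  apply: (@cintegrableM_bounded _ _ _ nu' (fun y => tensor a x * P y)
    (fun y => expi (2 * pi * dotprod (x - p) y)) 2).
  - by apply: cintegrableZ; exact: iE.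
  - exact: (mexp _ _ (cst x) id).
  - by move=> q; exact: cabs_expi.
have F2 y : cintegrable (lebesgue_rV d) (fun x => F (x, y)).
  apply: (@cintegrableM_bounded _ _ _ (lebesgue_rV d) (fun x => tensor a x * P y)
    (fun x => expi (2 * pi * dotprod (x - p) y)) 2).
  - have := cintegrableZ (P y) tensor_int; congr cintegrable; apply/funext => x.
    by rewrite mulrC.
  - exact: (mexp _ _ id (cst y)).
  - by move=> q; exact: cabs_expi.
have inner x : cintegral nu' (fun y => F (x, y)) = 0.
  have [ax|/eqP ax] := eqVneq (tensor a x) 0.
    rewrite (_ : (fun y => _) = fun=> 0) ?cintegral0//.
    by apply/funext => y; rewrite /F/= ax !mul0r.
  have bs : bumps (fun i t => a i (t + (x - p) 0 i)) by move=> i; exact: bump_shift.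
  have ss : supported (fun i t => a i (t + (x - p) 0 i)) (p - x) r.
    move=> i t h; apply: sa; rewrite !mxE in h *.
    by have -> : t + (x 0 i - p 0 i) - 0 = t - (p 0 i - x 0 i) by ring.
  have xr : box 0 r x by apply: supported_box sa _; exact/eqP.
  have T0 : fourier_measure nu (tensor (fun i t => a i (t + (x - p) 0 i))) = 0.
    apply: (fourier_measure_eq0 tnu d0 bs ss) => z zr; apply: pspec => i.
    have := zr i; have := xr i; rewrite !mxE subr0 => h1 h2.
    have -> : z 0 i - p 0 i = (z 0 i - (p 0 i - x 0 i)) - x 0 i by ring.
    by rewrite (le_trans (ler_normB _ _))//; lra.
  rewrite -cE (_ : (fun y => _) = (fun y => tensor a x *
    fourier (tensor (fun i t => a i (t + (x - p) 0 i))) y)); last first.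
    by apply/funext => y; rewrite fourier_tensor_shift// -/P /F/=; ring.
  rewrite cintegralZ; last exact: tempered_cintegrable_fourier.
  by rewrite -/(fourier_measure nu _) T0 mulr0.
have outer y : cintegral (lebesgue_rV d) (fun x => F (x, y)) =
    ((power_spectrum a y)%:C)%C * expi (- (2 * pi * dotprod p y)).
  rewrite power_spectrumE// -/P [P (- y)]/P /fourier mulrAC -cintegralZ; last first.
    exact: cintegrable_tensor_wave.
  apply: eq_cintegral => x; rewrite /F/= dotprodNl dotprodDl dotprodNl.
  rewrite (dotprodC x y) mulrDr expiD !mulrN opprK; ring.
under eq_cintegral do rewrite -outer.
rewrite cE (cintegral21 F_int)// -(cintegral12 F_int)//.
rewrite (eq_cintegral _ inner); exact: cintegral0.
Qed.

(** psi^ is integrable and bounded. *)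
Lemma power_spectrum_integrable a : bumps a ->
  nu.-integrable setT (EFin \o power_spectrum a).
Proof.
move=> ba; have P_int := tempered_cintegrable_fourier tnu d0 ba.
have [K hK] := fourier_tensor_decay 0 ba d0.
have mP := cmeasurable_fourier_tensor ba; have [mr mi] := mP.
apply: (@le_integrable _ _ _ nu setT measurableT _
  (EFin \o (fun y => K * cabs (fourier (tensor a) y)))).
- by apply/measurable_EFinP; apply: measurable_funD; exact: measurable_funX.
- move=> y _ /=; rewrite lee_fin (le_trans _ (ler_norm _))// ger0_norm ?abs2_ge0//.
  have := hK y; rewrite mul1r => hy.
  apply: (@le_trans _ _ (cabs (fourier (tensor a) y) ^+ 2)); last first.
    by rewrite expr2 ler_wpM2r// cabs_ge0.
  rewrite /power_spectrum /abs2 /cabs -(real_normK (num_real (complex.Re _))).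
  rewrite -(real_normK (num_real (complex.Im _))).
  rewrite sqrrD lerD2r lerDl mulrn_wge0// mulr_ge0//.
- exact: (integrableZl measurableT K (cintegrable_cabs P_int)).
Qed.

End Autocorrelation.

(** * The spectrum avoids a cone around L *)

Section Cone.
Context {R : realType} {d : nat}.
Implicit Types (x y p q : 'rV[R]_d) (L : {vspace 'rV[R]_d}).

Lemma enormZ (c : R) x : enorm (c *: x) = `|c| * enorm x.
Proof.
rewrite /enorm /dotprod -sqrtr_sqr -sqrtrM ?sqr_ge0// mulr_sumr.
by congr Num.sqrt; apply: eq_bigr => i _; rewrite !mxE; ring.
Qed.

Lemma enorm0 : enorm (0 : 'rV[R]_d) = 0.
Proof. by rewrite -(scale0r (0 : 'rV[R]_d)) enormZ normr0 mul0r. Qed.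

Lemma enorm_eq0 x : enorm x = 0 -> x = 0.
Proof.
move=> x0; apply/rowP => i; rewrite mxE; apply/eqP; rewrite -normr_le0 -x0.
exact: coord_le_enorm.
Qed.

Lemma enorm_gt0 x : x != 0 -> 0 < enorm x.
Proof.
by move=> x0; rewrite lt_neqAle enorm_ge0 andbT eq_sym; apply: contra x0 => /eqP/enorm_eq0/eqP.
Qed.

Lemma enorm_normalize x : x != 0 -> enorm ((enorm x)^-1 *: x) = 1.
Proof.
by move=> x0; rewrite enormZ normfV ger0_norm ?enorm_ge0// mulVf// gt_eqF// enorm_gt0.
Qed.

Lemma continuous_row_sum (F : 'I_d -> 'rV[R]_d -> R) :
  (forall i, continuous (F i)) -> continuous (fun x => \sum_(i < d) F i x : R).
Proof.
move=> cF.
pose g (s : seq 'I_d) : 'rV[R]_d -> R := fun x => \sum_(i <- s) F i x.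
suff h s : continuous (g s) by exact: h.
elim: s => [|i s IH].
  have -> : g [::] = cst 0 by apply/funext => y; rewrite /g big_nil.
  exact: cst_continuous.
have -> : g (i :: s) = F i \+ g s.
  by apply/funext => y; rewrite /g big_cons.
by move=> x; apply: continuousD; [exact: cF|exact: IH].
Qed.

Lemma continuous_enorm : continuous (@enorm R d).
Proof.
rewrite (_ : @enorm R d = (@Num.sqrt R) \o (fun x => \sum_(i < d) (x 0 i * x 0 i)))//.
move=> x; apply: continuous_comp; last exact: sqrt_continuous.
apply: continuous_row_sum => i y.
by apply: continuousM; exact: coord_continuous.
Qed.

(** Membership in [L] says that [z] is fixed by the projection onto [L], an equality between
    linear, hence continuous, functions of the coordinates. *)
Lemma closed_vspace L : closed [set z : 'rV[R]_d | z \in L].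
Proof.
pose h (j : 'I_d) (z : 'rV[R]_d) : R := \sum_(i < d) z 0 i * (projv L 'e_i) 0 j.
have ch j : continuous (h j).
  apply: continuous_row_sum => i y.
  by apply: continuousM; [exact: coord_continuous|exact: cst_continuous].
have hE z j : h j z = projv L z 0 j.
  rewrite {2}(row_sum_delta z) linear_sum/= summxE; apply: eq_bigr => i _.
  by rewrite linearZ/= mxE.
have -> : [set z : 'rV[R]_d | z \in L] =
    \bigcap_j ((fun z : 'rV[R]_d => z 0 j - h j z) @^-1` [set 0]).
  apply/seteqP; split => z /=.
    by move=> zL j _ /=; rewrite hE projv_id// subrr.
  move=> zL; have -> : z = projv L z; last exact: memv_proj.
  by apply/rowP => j; have /eqP := zL j I; rewrite hE subr_eq0 => /eqP.
apply: closed_bigI => j _; apply: closed_comp; last exact: closed_eq.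
move=> z _; apply: continuousB; [exact: coord_continuous|exact: ch].
Qed.

Lemma compact_vspace_sphere L : compact ([set z : 'rV[R]_d | z \in L] `&` unit_sphere).
Proof.
apply: (@subclosed_compact _ _ (box 0 1)).
- apply: closedI; first exact: closed_vspace.
  rewrite (_ : unit_sphere = @enorm R d @^-1` [set 1])//.
  by apply: closed_comp; [move=> z _; exact: continuous_enorm|exact: closed_eq].
- exact: box_compact.
- by move=> z [_ z1] i; rewrite mxE subr0 -z1 coord_le_enorm.
Qed.

Lemma lebesgue_number (K V : set 'rV[R]_d) : compact K -> (forall q, K q -> nbhs q V) ->
  exists2 e : R, 0 < e & forall q, K q -> ball q e `<=` V.
Proof.
move=> /compact_near_coveringP cK KV.
have [|e /= e0 H] := cK R 0^'+ (fun e q => ball q e `<=` V) _ _; last first.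
  exists (e / 2); first by rewrite divr_gt0.
  apply: (H (e / 2)); rewrite /= ?divr_gt0// sub0r normrN gtr0_norm ?divr_gt0//.
  by rewrite ltr_pdivrMr// ltr_pMr// ltr1n.
move=> q /KV /nbhs_ballP[r /= r0 rV].
have r20 : 0 < r / 2 by rewrite divr_gt0.
exists (ball q (r / 2), [set e | e < r / 2]) => [|[q' e] [/= qq' er] y q'y].
  by split => /=; [exact: nbhsx_ballx|exact: nbhs_right_lt].
apply: rV; rewrite [r]splitr; apply: ball_triangle qq' _.
by apply: le_ball q'y; exact: ltW.
Qed.

Variables (nu : {measure set 'rV[R]_d -> \bar R}).

(** The points [z] with [z / enorm z] in the interior of [U] form an open cone around the
    compact set of unit vectors of [L], which has positive distance to the complement of
    the cone.  Scaling by [enorm p] turns this distance into one of order [enorm p]. *)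
Lemma spec_avoids_box L (U : set 'rV[R]_d) (r : R) : 0 < r ->
  set_nbhs ([set z | z \in L] `&` unit_sphere) U -> spec_directions nu `&` U = set0 ->
  exists2 M : R, 0 < M & forall p, p \in L -> M <= enorm p ->
    forall x, box p r x -> ~ spec nu x.
Proof.
move=> r0 /set_nbhsP[C [oC LC CU]] specU.
pose V := [set z : 'rV[R]_d | z != 0 /\ C ((enorm z)^-1 *: z)].
have KV q : ([set z | z \in L] `&` unit_sphere) q -> nbhs q V.
  move=> [qL q1].
  have q0 : q != 0.
    apply/eqP => q0; move: q1; rewrite /unit_sphere/= q0 enorm0 => /eqP.
    by rewrite eq_sym oner_eq0.
  have cn : {for q, continuous (fun z : 'rV[R]_d => (enorm z)^-1 *: z)}.
    apply: (@continuousZ R _ _ (fun z => (enorm z)^-1) id); last exact: cvg_id.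
    apply: (@continuousV R _ (@enorm R d)); last exact: continuous_enorm.
    by rewrite gt_eqF// enorm_gt0.
  have Cq : nbhs ((enorm q)^-1 *: q) C.
    by apply: open_nbhs_nbhs; split => //; rewrite q1 invr1 scale1r; apply: LC.
  have N1 := cn _ Cq.
  have N2 : nbhs q [set z : 'rV[R]_d | enorm z != 0].
    have : nbhs (enorm q) [set t : R | t != 0].
      by apply: open_nbhs_nbhs; split; [exact: open_neq|rewrite /= gt_eqF// enorm_gt0].
    by move/continuous_enorm.
  have := @filterI _ (nbhs q) (nbhs_filter q) _ _ N1 N2.
  apply: (@filterS _ (nbhs q) (nbhs_filter q)) => z [/= Cz z0]; split => //.
  by apply: contra z0 => /eqP ->; rewrite enorm0.
have [e e0 eV] := lebesgue_number (@compact_vspace_sphere L) KV.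
exists (2 * r / e) => [|p pL pM x xr sx]; first by rewrite divr_gt0// mulr_gt0.
have p0 : 0 < enorm p by rewrite (lt_le_trans _ pM)// divr_gt0// mulr_gt0.
have pn0 : p != 0.
  by apply: contraTneq p0 => ->; rewrite enorm0 ltxx.
have [x0 Cx] : V ((enorm p)^-1 *: x).
  apply: (eV ((enorm p)^-1 *: p)).
    by split; [rewrite /= memvZ|exact: enorm_normalize].
  apply/rV_ballE => // i; rewrite !mxE -mulrBr normrM normfV (gtr0_norm p0) distrC.
  rewrite (le_lt_trans (ler_wpM2l _ (xr i)))// ?invr_ge0 ?enorm_ge0//.
  rewrite ltr_pdivrMl//; move: pM; rewrite ler_pdivrMr//; lra.
have xn0 : x != 0 by apply: contraNneq x0 => ->; rewrite scaler0.
have nE : (enorm ((enorm p)^-1 *: x))^-1 *: ((enorm p)^-1 *: x) = (enorm x)^-1 *: x.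
  rewrite enormZ normfV (gtr0_norm p0) scalerA invfM invrK; congr (_ *: _).
  by rewrite mulrAC mulfV ?mul1r// gt_eqF.
have : (spec_directions nu `&` U) ((enorm x)^-1 *: x).
  split; last by apply: CU; rewrite -nE.
  split; first exact: enorm_normalize.
  exists (enorm x); first exact: enorm_gt0.
  by rewrite scalerA mulfV ?scale1r// gt_eqF// enorm_gt0.
by rewrite specU.
Qed.

End Cone.

(** * Separated points of L *)

Section SeparatedPoints.
Context {R : realType} {d : nat}.
Implicit Types (L : {vspace 'rV[R]_d}).

(** The coordinates in a basis are bounded linear functions. *)
Lemma enorm_vbasis_sum L : exists2 A : R, 0 < A & forall (z : 'I_(\dim L) -> R) j,
  `|z j| <= A * enorm (\sum_i z i *: (vbasis L)`_i).
Proof.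
pose A j : R := \sum_(i < d) `|coord (vbasis L) j 'e_i|.
have A0 j : 0 <= A j by exact: sumr_ge0.
exists (1 + \sum_j A j) => [|z j]; first by rewrite ltr_wpDr// sumr_ge0.
pose u := \sum_i z i *: (vbasis L)`_i; rewrite -/u.
have <- : coord (vbasis L) j u = z j by rewrite coord_sum_free// (basis_free (vbasisP L)).
rewrite (@le_trans _ _ (A j * enorm u))//; last first.
  rewrite ler_wpM2r ?enorm_ge0// (bigD1 j)//= addrCA lerDl addr_ge0// sumr_ge0//.
rewrite {1}(row_sum_delta u) linear_sum/= (le_trans (ler_norm_sum _ _ _))//.
rewrite mulr_suml; apply: ler_sum => i _.
by rewrite linearZ/= normrM mulrC ler_wpM2l// coord_le_enorm.
Qed.

(** The points are the combinations of a basis with coefficients in {0, ..., n-1}, scaled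
    so that two of them, whose coefficients differ by at least 1 somewhere, are [M] apart. *)
Lemma separated_points L (M : R) : 0 < M -> exists2 B : R, 0 <= B &
  forall n, exists p : {ffun 'I_(\dim L) -> 'I_n} -> 'rV[R]_d,
  [/\ forall m m', p m - p m' \in L,
      forall m m', m != m' -> M <= enorm (p m - p m') &
      forall m z, `|dotprod (p m) z| <= B * n%:R * enorm z].
Proof.
move=> M0; have [A A0 hA] := enorm_vbasis_sum L.
pose b j := (vbasis L)`_j.
exists (\sum_(i < d) \sum_(j < \dim L) M * A * `|b j 0 i|).
  by apply: sumr_ge0 => i _; apply: sumr_ge0 => j _; rewrite !mulr_ge0// ltW.
move=> n; pose p (m : {ffun 'I_(\dim L) -> 'I_n}) : 'rV[R]_d :=
  (M * A) *: \sum_j (m j)%:R *: b j.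
have pB m m' : p m - p m' = (M * A) *: \sum_j ((m j)%:R - (m' j)%:R) *: b j.
  rewrite /p -scalerBr -sumrB; congr (_ *: _); apply: eq_bigr => j _.
  by rewrite scalerBl.
exists p; split => [m m'|m m' mm'|m z].
- rewrite pB memvZ// memv_suml// => j _; rewrite memvZ// vbasis_mem//.
  by rewrite mem_nth// size_tuple.
- have [j mj] : exists j, m j != m' j.
    apply/existsP; rewrite -negb_forall; apply: contra mm' => /forallP h.
    by apply/eqP/ffunP => j; exact/eqP.
  rewrite pB enormZ gtr0_norm ?mulr_gt0// -mulrA ler_peMr ?(ltW M0)//.
  rewrite (le_trans _ (hA (fun j => (m j)%:R - (m' j)%:R) j))//.
  have nm : (m j : nat) != m' j by [].
  case: (ltngtP (m j) (m' j)) nm => // h _.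
    by rewrite distrC -natrB ?(ltnW h)// normr_nat ler1n subn_gt0.
  by rewrite -natrB ?(ltnW h)// normr_nat ler1n subn_gt0.
- rewrite (le_trans (dotprod_le _ _))// ler_wpM2r ?enorm_ge0// mulr_suml.
  apply: ler_sum => i _; rewrite !mxE summxE normrM (gtr0_norm (mulr_gt0 M0 A0)).
  rewrite (le_trans (ler_wpM2l _ (ler_norm_sum _ _ _))) ?mulr_ge0 ?(ltW M0) ?(ltW A0)//.
  rewrite mulr_sumr mulr_suml; apply: ler_sum => j _.
  rewrite mxE normrM normr_nat mulrA [leRHS]mulrAC ler_wpM2r//.
  by rewrite ler_wpM2l ?mulr_ge0 ?(ltW M0) ?(ltW A0)// ler_nat ltnW.
Qed.

End SeparatedPoints.

(** * Exponential sums *)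

Section ExponentialSum.
Context {R : realType} {d : nat} {I : finType}.
Implicit Types (x y : 'rV[R]_d) (p : I -> 'rV[R]_d).

Definition expsum p y : R[i] := \sum_m expi (2 * pi * dotprod (p m) y).

Lemma expsum_conj p y : (complex.Re (expsum p y) -i* complex.Im (expsum p y))%C =
  \sum_m expi (- (2 * pi * dotprod (p m) y)).
Proof.
rewrite /expsum !raddf_sum/=.
have -> : (\sum_m expi (- (2 * pi * dotprod (p m) y))) =
  \sum_m (cos (2 * pi * dotprod (p m) y) -i* sin (2 * pi * dotprod (p m) y))%C.
  by apply: eq_bigr => m _; rewrite /expi cosN sinN.
elim: (index_enum I) => [|i s IH]; first by rewrite !big_nil; apply/eqP;
  rewrite eq_complex/= ?oppr0 !eqxx.
by rewrite !big_cons -IH; simpc; congr (_ +i* _)%C; rewrite ?opprD.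
Qed.

Lemma abs2_expsum p y : ((abs2 (expsum p y))%:C)%C =
  \sum_m \sum_m' expi (- (2 * pi * dotprod (p m' - p m) y)).
Proof.
rewrite abs2E expsum_conj /expsum mulr_suml; apply: eq_bigr => m _.
rewrite mulr_sumr; apply: eq_bigr => m' _; rewrite -expiD; congr expi.
by rewrite dotprodDl dotprodNl; ring.
Qed.

Lemma cos_ge_half (t : R) : `|t| <= 2^-1 -> 2^-1 <= cos t.
Proof.
wlog t0 : t / 0 <= t => [H|] th.
  have [t0|t0] := lerP 0 t; first exact: H.
  by rewrite -cosN; apply: H; rewrite ?normrN// oppr_ge0 ltW.
have [|c _] := @MVT_segment R cos (fun s : R => - sin s) 0 t t0.
  by apply: continuous_subspaceT => x; exact: continuous_cos.
rewrite cos0 subr0 => h.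
have := sin_le1 c; move: th; rewrite ger0_norm// => th s1.
have : sin c * t <= t by rewrite ler_piMl.
by move: h; lra.
Qed.

Lemma expsum_ge p y : (forall m, `|2 * pi * dotprod (p m) y| <= 2^-1) ->
  (#|I|%:R / 2) ^+ 2 <= abs2 (expsum p y).
Proof.
move=> hp; rewrite /abs2 ler_wpDr ?sqr_ge0// lerXn2r ?nnegrE ?divr_ge0//.
  rewrite /expsum raddf_sum/= sumr_ge0// => m _.
  by rewrite (le_trans _ (cos_ge_half (hp m)))// invr_ge0.
rewrite /expsum raddf_sum/= -sum1_card natr_sum mulr_suml; apply: ler_sum => m _.
by rewrite mul1r; exact: cos_ge_half.
Qed.

Lemma measurable_abs2_expsum p x : measurable_fun setT (fun y => abs2 (expsum p (y - x))).
Proof.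
have me : cmeasurable (fun y => expsum p (y - x)).
  have h m : cmeasurable (fun y => expi (2 * pi * dotprod (p m) (y - x))).
    apply: cmeasurable_expi; apply: measurable_funM => //.
    apply: measurable_dotprod => //; apply: measurable_fun_rV => i.
    under eq_fun do rewrite !mxE.
    by apply: measurable_funD => //; exact: measurable_fun_coord.
  rewrite /expsum; split.
    under eq_fun do rewrite raddf_sum.
    by apply: measurable_sum => m; exact: (h m).1.
  under eq_fun do rewrite raddf_sum.
  by apply: measurable_sum => m; exact: (h m).2.
by apply: measurable_funD; apply: measurable_funX; [exact: me.1|exact: me.2].
Qed.

End ExponentialSum.

(** * Bumps whose power spectrum is bounded below near a point *)

Section LowerBound.
Context {R : realType}.
Local Notation mu := (@lebesgue_measure R).

Lemma integral_cutoff_gt0 (r : R) : 0 < r -> 0 < \int[mu]_t cutoff r 0 t.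
Proof.
move=> r0; pose B := `[- (r / 2), r / 2]%classic : set (measurableTypeR R).
have mB : measurable B by exact: measurable_itv.
have BE : mu B = r%:E.
  rewrite lebesgue_measure_itv/= lte_fin ifT; last by lra.
  by rewrite -EFinB; congr _%:E; lra.
apply: (@lt_le_trans _ _ (\int[mu]_t \1_B t)).
  rewrite /Rintegral integral_indic// setIT.
  by have := congr1 fine BE => /= h; apply: (lt_le_trans r0); rewrite -h.
have Bcut t : \1_B t <= cutoff r 0 t.
  rewrite indicE; case: (boolP (t \in B)) => [|_]; last exact: cutoff_ge0.
  rewrite inE /B/= in_itv/= => /andP[h1 h2].
  by rewrite cutoff_eq1// subr0 ler_norml h1 h2.
have cint := bump_integrable (bump_cutoff 0 r0).
apply: le_Rintegral => //.
apply: le_integrable cint => //.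
  by apply/measurable_EFinP; exact: measurable_indic.
by move=> t _ /=; rewrite lee_fin !ger0_norm ?cutoff_ge0.
Qed.

Variable d : nat.
Implicit Types x y : 'rV[R]_d.

(** For a bump supported in a box of size [r], with [r] small in terms of [x], the phases in
    the transform at [y] are at most 1/2.  Then all cosines are at least 1/2, and the
    transform at [y] has real part at least half the integral of the bump. *)
Lemma power_spectrum_lower x : exists a r c, [/\ bumps a, 0 < r, supported a 0 r, 0 < c &
  forall y, enorm (y - x) <= 1 -> c <= power_spectrum a y].
Proof.
pose Y : R := \sum_(i < d) (`|x 0 i| + 1).
have Y0 : 0 <= Y by apply: sumr_ge0 => i _; rewrite addr_ge0.
have pi0 := pi_gt0 R.
have D0 : 0 < 4 * pi * (Y + 1) by rewrite !mulr_gt0// ltr_wpDl.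
pose r := (4 * pi * (Y + 1))^-1.
have r0 : 0 < r by rewrite invr_gt0.
pose a (i : 'I_d) := cutoff r 0.
have ba : bumps a by move=> i; exact: bump_cutoff.
have sa : supported a 0 r.
  by move=> i t; rewrite mxE => h; rewrite /a cutoff_eq0// ltW.
pose J : R := \prod_(i < d) \int[mu]_t a i t.
have J0 : 0 < J by apply: prodr_gt0 => i _; exact: integral_cutoff_gt0.
have aint i : cintegrable mu (fun t => ((a i t)%:C)%C).
  by split; [exact: bump_integrable (ba i)|exact: integrable0].
have [tint tJ] := cintegral_cprod aint.
have tE : cprod (fun i t => ((a i t)%:C)%C) = tensor a by apply/funext => y; rewrite tensorE.
rewrite tE in tint tJ.
have JE : \int[lebesgue_rV d]_y rprod a y = J.
  have := congr1 (@complex.Re R) tJ; rewrite /cintegral/= => ->.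
  rewrite (_ : \prod_(i < d) _ = (J%:C)%C)// /J rmorph_prod/=.
  apply: eq_bigr => i _; rewrite /cintegral/=; congr (_ +i* _)%C.
  by rewrite /Rintegral integral0.
exists a, r, ((J / 2) ^+ 2); split => //.
  by rewrite exprn_gt0// divr_gt0.
move=> y yx; rewrite /power_spectrum /abs2 ler_wpDr ?sqr_ge0//.
have J2 : 0 <= J / 2 by rewrite divr_ge0 ?(ltW J0).
suff h : J / 2 <= complex.Re (fourier (tensor a) y).
  by rewrite lerXn2r ?nnegrE// (le_trans J2).
rewrite -JE mulrC -RintegralZl//; last exact: tint.1.
have -> : complex.Re (fourier (tensor a) y) = \int[lebesgue_rV d]_z
  complex.Re (tensor a z * expi (- (2 * pi * dotprod y z))) by [].
apply: le_Rintegral => //.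
- exact: (integrableZl measurableT 2^-1 tint.1).
- exact: (cintegrable_tensor_wave y ba).1.
move=> z _; rewrite ReM/= mul0r subr0.
have a0 : 0 <= rprod a z by apply: prodr_ge0 => i _; exact: cutoff_ge0.
have [->|az] := eqVneq (rprod a z) 0; first by rewrite mul0r mulr0.
rewrite mulrC ler_wpM2l// cosN; apply: cos_ge_half.
have zr : box 0 r z.
  apply: supported_box sa _; rewrite /tensor; apply: contra az => /eqP h.
  by have /eqP := congr1 (@complex.Re R) h.
have dz : `|dotprod y z| <= Y * r.
  rewrite (le_trans (ler_norm_sum _ _ _))// /Y mulr_suml; apply: ler_sum => i _.
  rewrite normrM ler_pM//; last by have := zr i; rewrite mxE subr0.
  have := le_trans (coord_le_enorm (y - x) i) yx; rewrite !mxE => h.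
  by have := ler_normD (y 0 i - x 0 i) (x 0 i); rewrite subrK; lra.
rewrite normrM gtr0_norm ?mulr_gt0//.
rewrite (le_trans (ler_wpM2l _ dz)) ?mulr_ge0 ?(ltW pi0)//.
rewrite /r mulrA ler_pdivrMr//.
have : 0 <= pi * Y by rewrite mulr_ge0// ltW.
by lra.
Qed.

End LowerBound.

(** * Growth of the measure of small balls *)

Section MeasureBound.
Context {R : realType} {d : nat}.
Implicit Types (x y : 'rV[R]_d) (a : 'I_d -> R -> R).
Variables (nu : {measure set 'rV[R]_d -> \bar R}).
Hypotheses (tnu : tempered nu) (d0 : (0 < d)%N).

(** Only the diagonal terms of the expanded square survive the integration. *)
Lemma integral_power_expsum a r x (I : finType) (p : I -> 'rV[R]_d) :
  bumps a -> supported a 0 r ->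
  (forall m m', m != m' -> forall z, box (p m - p m') (2 * r) z -> ~ spec nu z) ->
  (\int[nu]_y (power_spectrum a y * abs2 (expsum p (y - x)))%:E =
   (#|I|%:R * \int[nu]_y power_spectrum a y)%:E)%E.
Proof.
move=> ba sa pspec; set G := power_spectrum a.
have Gint := power_spectrum_integrable tnu d0 ba.
have cG : cintegrable nu (fun y => ((G y)%:C)%C) by split; [exact: Gint|exact: integrable0].
pose w (q y : 'rV[R]_d) : R[i] := ((G y)%:C)%C * expi (- (2 * pi * dotprod q y)).
have cw q : cintegrable nu (w q).
  apply: (@cintegrableM_bounded _ _ _ nu _ _ 2) => //; last by move=> y; exact: cabs_expi.
  apply: cmeasurable_expi; apply: measurableT_comp => //; apply: measurable_funM => //.
  exact: (measurable_dotprod (measurable_cst q) (@measurable_id _ _ setT)).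
pose t m m' y : R[i] := expi (2 * pi * dotprod (p m' - p m) x) * w (p m' - p m) y.
have ct m m' : cintegrable nu (t m m') by exact: cintegrableZ.
have tE m m' : cintegral nu (t m m') =
    if m == m' then cintegral nu (fun y => ((G y)%:C)%C) else 0.
  rewrite /t cintegralZ//; case: eqVneq => [->|mm'].
    rewrite subrr (_ : w 0 = (fun y => ((G y)%:C)%C)).
      by rewrite /dotprod big1 ?mulr0 ?expi0 ?mul1r// => i _; rewrite mxE mul0r.
    apply/funext => y; rewrite /w /dotprod big1 ?mulr0 ?oppr0 ?expi0 ?mulr1// => i _.
    by rewrite mxE mul0r.
  rewrite [cintegral _ _](power_spectrum_orthogonal tnu d0 ba sa) ?mulr0//.
  by apply: pspec; rewrite eq_sym.
have sumE : (fun y => ((G y * abs2 (expsum p (y - x)))%:C)%C) =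
    (fun y => \sum_m \sum_m' t m m' y).
  apply/funext => y; rewrite rmorphM/= abs2_expsum mulr_sumr; apply: eq_bigr => m _.
  rewrite mulr_sumr; apply: eq_bigr => m' _.
  rewrite /t /w mulrCA -expiD; congr (_ * expi _).
  by rewrite !(dotprodC (p m' - p m)) dotprodDl dotprodNl; ring.
have [sint sE] := cintegrable_sum (index_enum I)
  (fun m => (cintegrable_sum (index_enum I) (fun m' => ct m m')).1).
have total : cintegral nu (fun y => ((G y * abs2 (expsum p (y - x)))%:C)%C) =
    ((#|I|%:R * \int[nu]_y G y)%:C)%C.
  rewrite sumE sE (eq_bigr (fun=> ((\int[nu]_y G y)%:C)%C)); last first.
    move=> m _; rewrite (cintegrable_sum _ (fun m' => ct m m')).2.
    rewrite (bigD1 m)//= tE eqxx big1 ?addr0.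
      by rewrite /cintegral/=; congr (_ +i* _)%C; rewrite /Rintegral integral0.
    by move=> m' mm'; rewrite tE eq_sym (negbTE mm').
  by rewrite sumr_const rmorphM/= rmorph_nat mulr_natl.
have := congr1 (@complex.Re R) total; rewrite /cintegral/= => <-.
rewrite /Rintegral fineK//; apply: integrable_fin_num => //.
by have := sint; rewrite -sumE => -[].
Qed.

(** Restricts the integral of [integral_power_expsum] to a ball on which neither the power
    spectrum nor the exponential sum is small. *)
Lemma eball_expsum_bound a r x (c s : R) (I : finType) (p : I -> 'rV[R]_d) :
  bumps a -> supported a 0 r -> 0 <= c ->
  (forall m m', m != m' -> forall z, box (p m - p m') (2 * r) z -> ~ spec nu z) ->
  (forall y, enorm (y - x) <= s -> c <= power_spectrum a y) ->
  (forall y, enorm (y - x) <= s -> forall m, `|2 * pi * dotprod (p m) (y - x)| <= 2^-1) ->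
  ((c * (#|I|%:R / 2) ^+ 2)%:E * nu (eball x s) <=
   (#|I|%:R * \int[nu]_y power_spectrum a y)%:E)%E.
Proof.
move=> ba sa c0 pspec cG hp; rewrite -(integral_power_expsum x ba sa pspec).
have mB := measurable_eball x s.
have Gint := power_spectrum_integrable tnu d0 ba.
have K0 : 0 <= c * (#|I|%:R / 2) ^+ 2 by rewrite mulr_ge0// sqr_ge0.
have G0 y : 0 <= power_spectrum a y by exact: abs2_ge0.
have -> : ((c * (#|I|%:R / 2) ^+ 2)%:E * nu (eball x s) =
    \int[nu]_y ((c * (#|I|%:R / 2) ^+ 2)%:E * (\1_(eball x s) y)%:E))%E.
  rewrite ge0_integralZl//.
    by rewrite integral_indic// setIT.
  by apply/measurable_EFinP; exact: measurable_indic.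
apply: ge0_le_integral => //.
- by move=> y _; rewrite mule_ge0// lee_fin.
- by apply: measurable_funeM; apply/measurable_EFinP; exact: measurable_indic.
- apply/measurable_EFinP; apply: measurable_funM; last exact: measurable_abs2_expsum.
  by apply/measurable_EFinP; exact: measurable_int Gint.
move=> y _; rewrite -EFinM lee_fin indicE.
case: (boolP (y \in eball x s)) => [|_]; last first.
  by rewrite mulr0 mulr_ge0// abs2_ge0.
rewrite inE => ys; rewrite mulr1 ler_pM ?sqr_ge0//; first exact: cG.
by apply: expsum_ge => m; exact: hp.
Qed.

(** For [n] of order [rho / r], the ball of radius [r] lies in the ball of radius [rho / n], on
    which the phases of the points of [separated_points] are at most 1/2.  There
    [eball_expsum_bound] reads c (n^k / 2)^2 nu (B) <= n^k A. *)
Lemma eball_growth (L : {vspace 'rV[R]_d}) (U : set 'rV[R]_d) x :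
  set_nbhs ([set z | z \in L] `&` unit_sphere) U -> spec_directions nu `&` U = set0 ->
  exists C rho : R, [/\ 0 < C, 0 < rho & forall r, 0 < r -> r <= rho ->
    (nu (eball x r) <= (C * r ^+ \dim L)%:E)%E].
Proof.
move=> LU specU; have [a [s [c [ba s0 sa c0 cG]]]] := power_spectrum_lower x.
have s20 : 0 < 2 * s by rewrite mulr_gt0.
have [M M0 hM] := spec_avoids_box s20 LU specU.
have [B B0 hB] := separated_points L M0.
have pi0 := pi_gt0 R.
have D1 : 1 <= 1 + 4 * pi * B by rewrite lerDl !mulr_ge0// ltW.
pose rho := (1 + 4 * pi * B)^-1.
have rho0 : 0 < rho by rewrite invr_gt0 (lt_le_trans _ D1).
have rho1 : rho <= 1 by rewrite invf_le1// (lt_le_trans _ D1).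
pose A := \int[nu]_y power_spectrum a y.
have A0 : 0 <= A by apply: Rintegral_ge0 => y _; exact: abs2_ge0.
(* The constant rho is chosen so that 2 pi B rho <= 1/2. *)
have key n : (0 < n)%N ->
    (nu (eball x (rho / n%:R)) <= (4 * A / c * n%:R^-1 ^+ \dim L)%:E)%E.
  move=> n0; have [p [pL pM pB]] := hB n.
  have nR0 : 0 < n%:R :> R by rewrite ltr0n.
  have cardI : #|{ffun 'I_(\dim L) -> 'I_n}|%:R = n%:R ^+ \dim L :> R.
    by rewrite card_ffun !card_ord natrX.
  have N0 : 0 < n%:R ^+ \dim L :> R by rewrite exprn_gt0.
  have := @eball_expsum_bound a s x c (rho / n%:R) _ p ba sa (ltW c0).
  rewrite cardI => bound.
  have K0 : 0 < c * (n%:R ^+ \dim L / 2) ^+ 2 by rewrite mulr_gt0// exprn_gt0// divr_gt0.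
  have : ((c * (n%:R ^+ \dim L / 2) ^+ 2)%:E * nu (eball x (rho / n%:R)) <=
      (n%:R ^+ \dim L * A)%:E)%E.
    apply: bound.
    - by move=> m m' mm' z; apply: hM; [exact: pL|exact: pM].
    - move=> y yx; apply: cG; rewrite (le_trans yx)// ler_pdivrMr// mul1r.
      by rewrite (le_trans rho1)// ler1n.
    - move=> y yx m; rewrite normrM gtr0_norm ?mulr_gt0//.
      have h : `|dotprod (p m) (y - x)| <= B * rho.
        rewrite (le_trans (pB m _))//.
        rewrite (le_trans (ler_wpM2l _ yx)) ?mulr_ge0//.
        by rewrite -mulrA ler_wpM2l// mulrC divfK// gt_eqF.
      rewrite (le_trans (ler_wpM2l _ h)) ?mulr_ge0 ?(ltW pi0)//.
      by rewrite /rho mulrA ler_pdivrMr ?(lt_le_trans _ D1)//; lra.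
  rewrite -lee_pdivlMl// -EFinM => /le_trans; apply; rewrite lee_fin.
  rewrite le_eqVlt exprVn; apply/orP; left; apply/eqP; field.
  by rewrite !gt_eqF.
exists ((4 * A / c + 1) * (2 / rho) ^+ \dim L), rho; split => //.
  by rewrite mulr_gt0 ?exprn_gt0 ?divr_gt0// ltr_wpDl// divr_ge0 ?mulr_ge0// ltW.
move=> r r0 rrho; pose n := Num.truncn (rho / r).
have rho_r : 0 <= rho / r by rewrite divr_ge0// ltW.
have n1 : (0 < n)%N by rewrite /n truncn_gt0 ler_pdivlMr// mul1r.
have nR0 : 0 < n%:R :> R by rewrite ltr0n.
have nle : n%:R <= rho / r by rewrite truncn_le.
have nge : rho / r < n.+1%:R by exact: truncnS_gt.
apply: (@le_trans _ _ (nu (eball x (rho / n%:R)))).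
  apply: le_measure; rewrite ?inE; [exact: measurable_eball..|].
  move=> y yr; apply: (le_trans yr).
  by rewrite ler_pdivlMr// mulrC -ler_pdivlMr.
rewrite (le_trans (key _ n1))// lee_fin -[leRHS]mulrA -exprMn ler_pM//.
- by rewrite divr_ge0 ?mulr_ge0// ltW.
- by rewrite lerDl.
rewrite lerXn2r ?nnegrE ?invr_ge0 ?mulr_ge0 ?invr_ge0 ?(ltW nR0) ?(ltW r0)
  ?(ltW rho0) ?(le_trans ler01 D1)//.
have h2 : n.+1%:R <= 2 * n%:R :> R by rewrite -natrM ler_nat mul2n -addnn -addn1 leq_add2l.
have h3 : rho < 2 * n%:R * r.
  by rewrite -ltr_pdivrMr// (lt_le_trans nge).
rewrite mulrAC ler_pdivlMr// mulrC ler_pdivrMr// mulrAC ltW//.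
Qed.

End MeasureBound.

(** * From growth to dimension *)

Section LowerDimension.
Context {R : realType} {d : nat}.
Variables (nu : {measure set 'rV[R]_d -> \bar R}).

(** Since ln r < 0, the growth bound gives ln nu(B) / ln r >= k + ln C / ln r, and the last
    term tends to 0. *)
Lemma lower_dim_ge (k : nat) (x : 'rV[R]_d) (C rho : R) : 0 < C -> 0 < rho ->
  (forall r, 0 < r -> r <= rho -> (nu (eball x r) <= (C * r ^+ k)%:E)%E) ->
  (k%:R%:E <= lower_dim nu x)%E.
Proof.
move=> C0 rho0 nuC; rewrite /lower_dim; case: ifP => [_|_]; last exact: leey.
apply/lee_addgt0Pr => e e0; rewrite limf_einfE -leeBlDr//.
(* Below this radius, ln C / ln r is smaller than e in absolute value. *)
pose D := expR (- ((`|ln C| + 1) / e)).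
have D0 : 0 < D by exact: expR_gt0.
pose b := Num.min rho D.
have b0 : 0 < b by rewrite lt_min rho0 D0.
pose q (r : R) : \bar R := (lne (nu (eball x r)) / (ln r)%:E)%E.
apply: (@le_trans _ _ (ereal_inf (q @` `]0, b[%classic))); last first.
  apply: ereal_sup_ubound; exists `]0, b[%classic => //.
  near=> r; rewrite /= in_itv/=; apply/andP; split; near: r.
    exact: nbhs_right_gt.
  exact: nbhs_right_lt.
apply: le_ereal_inf_tmp => _ [r + <-]; rewrite /q /= in_itv/= lt_min => /and3P[r0 rrho rD].
have lnr : ln r < - ((`|ln C| + 1) / e).
  by rewrite -[ltRHS]expRK ltr_ln.
have lnr0 : ln r < 0.
  by rewrite (lt_trans lnr)// oppr_lt0 divr_gt0// ltr_wpDl.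
have nu0 : (0 <= nu (eball x r))%E by exact: measure_ge0.
move: (nuC r r0 (ltW rrho)) nu0.
rewrite inver lt_eqF//.
case: (nu (eball x r)) => [v||].
- rewrite !lee_fin => vC v0.
  have [v00|vn0] := eqVneq v 0.
    by rewrite v00 le0_lneNy// lt0_mulNye ?leey// lte_fin invr_lt0.
  have vpos : 0 < v by rewrite lt_def vn0 v0.
  rewrite (lne_EFin vpos) -EFinB -EFinM lee_fin ler_ndivlMr//.
  rewrite (@le_trans _ _ (ln (C * r ^+ k)))//.
    by rewrite ler_ln// posrE mulr_gt0// exprn_gt0.
  rewrite lnM ?posrE ?exprn_gt0// lnXn// -[ln r *+ k]mulr_natl.
  have h : `|ln C| + 1 < - ln r * e.
    by rewrite -ltr_pdivrMr// ltrNr.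
  have := ler_norm (ln C); lra.
- by rewrite leye_eq => /eqP.
- by rewrite leeNy_eq => _ /eqP.
Unshelve. all: by end_near. Qed.

End LowerDimension.

(** * The theorem *)

Theorem theorem1p3 (R : realType) (d k : nat)
    (nu : {measure set 'rV[R]_d -> \bar R}) (L : {vspace 'rV[R]_d}) :
  tempered nu ->
  (k < d)%N ->
  \dim L = k ->
  (exists2 U : set 'rV[R]_d,
     set_nbhs ([set z | z \in L] `&` unit_sphere) U &
     spec_directions nu `&` U = set0) ->
  forall x : 'rV[R]_d, (k%:R%:E <= lower_dim nu x)%E.
Proof.
move=> tnu kd dimL [U LU specU] x.
have [C [rho [C0 rho0 nuC]]] := eball_growth tnu (leq_ltn_trans (leq0n k) kd) x LU specU.
by rewrite -dimL; exact: lower_dim_ge C0 rho0 nuC.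
Qed.
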